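(* Let $(F_i)_{i\ge 0}$ be a Barlow–Evans sequence with projective limit $F_\infty$, let $(\mathcal{E}_0,\mathcal{F}_0)$ be a regular Dirichlet form on $L^2(F_0,\mu_{F_0})$, and let $\Delta_\infty$ be the Laplacian generated by $(\mathcal{E}_\infty,\mathcal{F}_\infty)$. Let $E_\lambda$, $\lambda\in\mathbb{R}$, be the spectral projection operators of $\Delta_\infty$. Then for all $\lambda\in\mathbb{R}$ and $i\in\mathbb{N}$, $$\mathfrak{D}'_i\cap E_\lambda(Dom(\Delta_\infty))=E_\lambda\mathfrak{D}'_i.$$
   Context: Spaces. $C_0[X]$ denotes the space of continuous real-valued functions on $X$ with compact support. A Barlow–Evans sequence consists of the following. $F_0$ is a locally compact, second-countable, Hausdorff space with a $\sigma$-finite Borel measure $\mu_{F_0}$; for each $i\ge1$, $G_i$ is a compact, second-countable, Hausdorff space with a Borel probability measure $\mu_{G_i}$; all these measures are Radon with full support. Inductively, for $i\ge 1$, $B_i\subset F_{i-1}$ is a closed subset, $F_i=((F_{i-1}\setminus B_i)\times G_i)\cup B_i$ (disjoint union), and $\pi_i:F_{i-1}\times G_i\to F_i$ is the map $\pi_i(x,g)=(x,g)$ if $x\in F_{i-1}\setminus B_i$ and $\pi_i(x,g)=x$ if $x\in B_i$. $F_i$ has the quotient topology from $\pi_i$ (a set is open iff its $\pi_i$-preimage is open). The map $\phi_i:F_i\to F_{i-1}$ is $\phi_i(x,g)=x$ for $x\in F_{i-1}\setminus B_i$, and $\phi_i(x)=x$ for $x\in B_i$. The Borel measure $\mu_{F_i}$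 is $\mu_{F_i}(A)=(\mu_{F_{i-1}}\times\mu_{G_i})(\pi_i^{-1}(A))$. Each $F_i$ is locally compact, second-countable, Hausdorff. For a map $p$, $p^*f=f\circ p$. $\|\cdot\|_i$ is the norm of $L^2(F_i,\mu_{F_i})$, $i=0,1,\dots,\infty$. Projective limit. $F_\infty=\{(x_i)_{i\ge0}\in\prod_i F_i:\phi_i(x_i)=x_{i-1}\ \forall i\ge1\}$ with the subspace topology of the product topology, and $\Phi_j:F_\infty\to F_j$ are the coordinate projections, so $\phi_j\circ\Phi_j=\Phi_{j-1}$. $\mu_{F_\infty}$ is the unique Borel measure on $F_\infty$ with $\mu_{F_\infty}(\Phi_i^{-1}(A))=\mu_{F_i}(A)$ for all $i\ge 0$ and all Borel $A\subset F_i$. Dirichlet forms. $(\mathcal{E}_0,\mathcal{F}_0)$ is a regular Dirichlet form on $L^2(F_0,\mu_{F_0})$ and $\mathfrak{F}_0=\mathcal{F}_0\cap C_0[F_0]$. For $i\ge1$, $\mathfrak{F}_i$ is the set of $f\in C_0[F_i]$ such that $\pi_i^*f(x,g)=\sum_{k=1}^n f_k(x)h_k(g)$ for some $n$, $f_k\in\mathfrak{F}_{i-1}$, $h_k\in C(G_i)$; for $f,h\in\mathfrak{F}_i$, $\mathcal{E}_i(f,h)=\int_{G_i}\mathcal{E}_{i-1}(\pi_i^*f(\cdot,g),\pi_i^*h(\cdot,g))\,d\mu_{G_i}(g)$; and $(\mathcal{E}_i,\mathcal{F}_i)$ is the closure of $(\mathcal{E}_i,\mathfrak{F}_i)$, i.e.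 $\mathcal{F}_i$ is the completion of $\mathfrak{F}_i$ in the norm $\mathcal{E}_i(f,f)^{1/2}+\|f\|_i$. On $\bigcup_i\Phi_i^*\mathfrak{F}_i$ set $\mathcal{E}_\infty(\Phi_i^*u,\Phi_i^*u)=\mathcal{E}_i(u,u)$, and let $(\mathcal{E}_\infty,\mathcal{F}_\infty)$ be the closure of this form, i.e. $\mathcal{F}_\infty$ is the closure of $\bigcup_i\Phi_i^*\mathfrak{F}_i$ in the norm $\mathcal{E}_\infty(f,f)^{1/2}+\|f\|_\infty$. All of these are regular Dirichlet forms. Laplacians. For a Dirichlet form $(\mathcal{E},\mathcal{F})$ the generator (Laplacian) $\Delta$ is the nonnegative self-adjoint operator such that $h\in Dom(\Delta)$ with $\Delta h=f$ iff $h\in\mathcal{F}$, $f\in L^2$ and $\mathcal{E}(h,v)=\langle f,v\rangle_{L^2}$ for all $v\in\mathcal{F}$. $\Delta_i$ is the generator of $(\mathcal{E}_i,\mathcal{F}_i)$, $i=0,1,\dots,\infty$. $E_\lambda$ is the spectral resolution of $\Delta_\infty$, $\Delta_\infty=\int_{\sigma(\Delta_\infty)}\lambda\,dE_\lambda$, i.e. $E_\lambda$ is the spectral projection of $\Delta_\infty$ for $(-\infty,\lambda]$. The spaces $\mathfrak{D}'_i$. $\mathfrak{D}'_0=\Phi_0^*Dom(\Delta_0)$ and, for $i\ge1$, $\mathfrak{D}'_i$ is the set of elements of $\Phi_i^*Dom(\Delta_i)$ that are orthogonal in $L^2(F_\infty,\mu_{F_\infty})$ to $\mathfrak{D}'_0,\dots,\mathfrak{D}'_{i-1}$;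 thus $\Phi_i^*Dom(\Delta_i)=\bigoplus_{j=0}^i\mathfrak{D}'_j$. *)

(* Defs.v *)
From HB Require Import structures.
From mathcomp Require Import all_boot all_order all_algebra.
From mathcomp Require Import all_classical all_reals all_analysis.
Set Implicit Arguments.
Unset Strict Implicit.
Unset Printing Implicit Defensive.
Import Order.TTheory GRing.Theory Num.Theory.
Import numFieldNormedType.Exports.
Local Open Scope classical_set_scope.
Local Open Scope ring_scope.

(* Measurable types are pointed in the library, so every space is nonempty. *)
Definition borel (T : ptopologicalType) := g_sigma_algebraType (@open T).

Section RegularityOfMeasures.
Variables (R : realType) (T : ptopologicalType).
Variable mu : {measure set (borel T) -> \bar R}.

Definition radon : Prop :=
  [/\ forall K : set T, compact K -> (mu K < +oo)%E,
      forall A : set (borel T), measurable A ->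
        mu A = ereal_inf [set mu U | U in [set U : set T | open U /\ A `<=` U]]
    & forall U : set T, open U ->
        mu U = ereal_sup
          [set mu K | K in [set K : set T | compact K /\ K `<=` U]]].

Definition full_support : Prop :=
  forall U : set T, open U -> U !=set0 -> (0 < mu U)%E.

End RegularityOfMeasures.

Definition C0_fun (R : realType) (T : topologicalType) : set (T -> R) :=
  [set f | continuous f /\ compact (closure [set x | f x != 0])].

(* Elements of L2 mu are representatives: equality in the Hilbert space
   L^2(mu) is equality mu-almost everywhere, and the sets of elements of L2 mu
   considered below are saturated for it. *)
Notation L2 mu := (LfunType mu (lee1n 2)).

Section HilbertSpace.
Context d (T : measurableType d) (R : realType).
Variable mu : {measure set T -> \bar R}.

Definition L2dot (f g : L2 mu) : R := \int[mu]_x (f x * g x).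

Definition L2norm (f : L2 mu) : R := fine ('N[mu]_2[EFin \o f])%E.

(* The junk value 0 is never used: all the functions to which it is applied
   in the sequel are continuous with compact support. *)
Definition toL2 (f : T -> R) : L2 mu := insubd (0 : L2 mu) f.

Definition ae_image (A : L2 mu -> L2 mu) (S : set (L2 mu)) : set (L2 mu) :=
  [set f | exists2 g, S g & f = A g %[ae mu]].

Record L2form := MkL2form {
  fdom : set (L2 mu) ;
  fval : L2 mu -> L2 mu -> R }.

Definition in_fdom (D : L2form) (f : T -> R) : Prop :=
  exists2 u : L2 mu, fdom D u & (u : T -> R) = f.

Definition fnorm (D : L2form) (u : L2 mu) : R :=
  Num.sqrt (fval D u u) + L2norm u.

Record nonneg_symmetric_form (D : L2form) : Prop := {
  fdom0 : fdom D 0 ;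
  fdomP : forall (a : R) u v, fdom D u -> fdom D v -> fdom D (a *: u + v) ;
  fdom_ae : forall u v : L2 mu, fdom D u -> u = v %[ae mu] -> fdom D v ;
  fval_ae : forall u v w : L2 mu, fdom D u -> fdom D w -> u = v %[ae mu] ->
    fval D u w = fval D v w ;
  fval_linear : forall (a : R) u v w, fdom D u -> fdom D v -> fdom D w ->
    fval D (a *: u + v) w = a * fval D u w + fval D v w ;
  fval_sym : forall u v, fdom D u -> fdom D v -> fval D u v = fval D v u ;
  fval_ge0 : forall u, fdom D u -> 0 <= fval D u u }.

Definition fcomplete (D : L2form) : Prop :=
  forall u : nat -> L2 mu, (forall n, fdom D (u n)) ->
    (forall e : R, 0 < e -> exists N, forall m n, (N <= m)%N -> (N <= n)%N ->
      fnorm D (u m - u n) < e) ->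
    exists2 v, fdom D v & fnorm D (u n - v) @[n --> \oo] --> (0 : R).

Definition closed_form (D : L2form) : Prop :=
  nonneg_symmetric_form D /\ fcomplete D.

Definition fdense (D : L2form) : Prop :=
  forall (f : L2 mu) (e : R), 0 < e -> exists2 u, fdom D u & L2norm (f - u) < e.

Definition markovian (D : L2form) : Prop :=
  forall u v : L2 mu, fdom D u ->
    v = (fun x => Num.min (Num.max (u x) 0) 1) %[ae mu] ->
    fdom D v /\ fval D v v <= fval D u u.

Definition dirichlet_form (D : L2form) : Prop :=
  [/\ closed_form D, fdense D & markovian D].

Definition is_core (D : L2form) (core : set (T -> R)) : Prop :=
  (forall f, core f -> in_fdom D f) /\
  forall u (e : R), fdom D u -> 0 < e ->
    exists2 v : L2 mu, core v & fnorm D (u - v) < e.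

(* graph of the generator: laplacian D h f means h \in Dom and Delta h = f *)
Definition laplacian (D : L2form) (h f : L2 mu) : Prop :=
  fdom D h /\ forall v, fdom D v -> fval D h v = L2dot f v.

Definition domL (D : L2form) : set (L2 mu) :=
  [set h | exists f, laplacian D h f].

(* E is the resolution of the identity of the operator with graph A.  The
   equality A = \int x dE_x is expressed through the finite measures
   d<E_x f, f>: f is in Dom(A) iff x is square integrable, and then
   <A f, f> = \int x d<E_x f, f>; the values <A f, g> for g in Dom(A) are
   obtained from these by polarization. *)
Record spectral_resolution (A : L2 mu -> L2 mu -> Prop)
    (E : R -> L2 mu -> L2 mu) : Prop := {
  resol_ae : forall x (f g : L2 mu), f = g %[ae mu] -> E x f = E x g %[ae mu] ;
  resol_linear : forall x a (f g : L2 mu),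
    E x (a *: f + g) = (a *: E x f + E x g : L2 mu) %[ae mu] ;
  resol_sym : forall x (f g : L2 mu), L2dot (E x f) g = L2dot f (E x g) ;
  resol_min : forall x y (f : L2 mu),
    E x (E y f) = E (Num.min x y) f %[ae mu] ;
  resol_right_continuous : forall x (f : L2 mu),
    L2norm (E y f - E x f) @[y --> x^'+] --> (0 : R) ;
  resol_ninfty : forall f : L2 mu, L2norm (E y f) @[y --> -oo] --> (0 : R) ;
  resol_pinfty : forall f : L2 mu, L2norm (f - E y f) @[y --> +oo] --> (0 : R) ;
  resol_integral : forall f : L2 mu, exists m : cumulative R R,
    [/\ forall x, m x = L2dot (E x f) f,
        (exists k, A f k) <->
          (\int[lebesgue_stieltjes_measure m]_x (x ^+ 2)%:E < +oo)%E
      & forall k, A f k ->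
          L2dot k f = \int[lebesgue_stieltjes_measure m]_x x] }.

End HilbertSpace.

Definition regular_form (R : realType) (T : ptopologicalType)
    (mu : {measure set (borel T) -> \bar R}) (D : L2form mu) : Prop :=
  is_core D [set f | in_fdom D f /\ C0_fun (f : T -> R)] /\
  forall (f : T -> R) (e : R), C0_fun f -> 0 < e ->
    exists2 v : T -> R, in_fdom D v /\ C0_fun v & forall x, `|f x - v x| < e.

Section BarlowEvansStep.
Variables (F G : ptopologicalType) (B : set F).

Definition glue_space : Type := ({x : F | ~ B x} * G + {x : F | B x})%type.

Definition glue_pi (xg : F * G) : glue_space :=
  match pselect (B xg.1) with
  | left Bx => inr (exist _ xg.1 Bx)
  | right nBx => inl (exist _ xg.1 nBx, xg.2)
  end.

Definition glue_phi (y : glue_space) : F :=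
  match y with inl xg => sval xg.1 | inr x => sval x end.

HB.instance Definition _ := gen_eqMixin glue_space.
HB.instance Definition _ := gen_choiceMixin glue_space.
HB.instance Definition _ := isPointed.Build glue_space (glue_pi (point, point)).

Definition glue_open (U : set glue_space) : Prop := open (glue_pi @^-1` U).

Let glue_openT : glue_open setT.
Proof. by rewrite /glue_open preimage_setT; exact: openT. Qed.

Let glue_openI : setI_closed glue_open.
Proof. by move=> U V oU oV; rewrite /glue_open preimage_setI; exact: openI. Qed.

Let glue_open_bigU (I : Type) (f : I -> set glue_space) :
  (forall i, glue_open (f i)) -> glue_open (\bigcup_i f i).
Proof.
by move=> of_; rewrite /glue_open preimage_bigcup; apply: bigcup_open => i _;
  exact: of_.
Qed.

HB.instance Definition _ :=
  isOpenTopological.Build glue_space glue_openT glue_openI glue_open_bigU.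

End BarlowEvansStep.

Arguments glue_pi {F} G B.
Arguments glue_phi {F} G B.

(* The data G_1, B_1 \subset F_0, G_2, B_2 \subset F_1, ... over F_0 = F; it is
   coinductive because the type of B_(i+1) depends on the earlier data. *)
CoInductive BE_tower (F : ptopologicalType) : Type :=
  BETower (G : ptopologicalType) (B : set F) (_ : BE_tower (glue_space G B)).

Section TowerProjections.
Variables (F : ptopologicalType) (t : BE_tower F).

Definition towerG : ptopologicalType := let: BETower G _ _ := t in G.

Definition towerB : set F := let: BETower _ B _ := t in B.

Definition tower_next : BE_tower (glue_space towerG towerB) :=
  match t return BE_tower (glue_space (let: BETower G _ _ := t in G)
                                    (let: BETower _ B _ := t in B)) with
  | BETower _ _ t' => t'
  end.

End TowerProjections.

Section BarlowEvansSequence.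
Variables (F0 : ptopologicalType) (t : BE_tower F0).

Fixpoint BE_stage (i : nat) : {F : ptopologicalType & BE_tower F} :=
  match i with
  | 0 => existT _ F0 t
  | j.+1 => existT (fun F => BE_tower F) _ (tower_next (projT2 (BE_stage j)))
  end.

Definition BE_F (i : nat) : ptopologicalType := projT1 (BE_stage i).

(* BE_G i, BE_B i, BE_pi i and BE_phi i are G_(i+1), B_(i+1), pi_(i+1) and
   phi_(i+1) in the usual numbering. *)
Definition BE_G (i : nat) : ptopologicalType := towerG (projT2 (BE_stage i)).

Definition BE_B (i : nat) : set (BE_F i) := towerB (projT2 (BE_stage i)).

Definition BE_pi (i : nat) : BE_F i * BE_G i -> BE_F i.+1 :=
  glue_pi (BE_G i) (@BE_B i).

Definition BE_phi (i : nat) : BE_F i.+1 -> BE_F i :=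
  glue_phi (BE_G i) (@BE_B i).

Definition BE_limit : Type :=
  {x : forall i, BE_F i | forall i, BE_phi (x i.+1) = x i}.

Definition BE_Phi (j : nat) (x : BE_limit) : BE_F j := sval x j.

Let limit_point : BE_limit.
Proof.
exists (fun i => point) => i; rewrite /BE_phi.
change (glue_phi _ _ (glue_pi (BE_G i) (@BE_B i) (point, point)) = point).
by rewrite /glue_pi; case: pselect.
Defined.

HB.instance Definition _ := gen_eqMixin BE_limit.
HB.instance Definition _ := gen_choiceMixin BE_limit.
HB.instance Definition _ := isPointed.Build BE_limit limit_point.
HB.instance Definition _ := Topological.copy BE_limit
  (initial_topology (fun x : BE_limit => (sval x : prod_topology BE_F))).

Definition BE_spaces : Prop :=
  [/\ [/\ locally_compact [set: F0], @second_countable F0 & hausdorff_space F0],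
      forall i, [/\ compact [set: BE_G i], @second_countable (BE_G i)
                  & hausdorff_space (BE_G i)]
    & forall i, closed (@BE_B i)].

End BarlowEvansSequence.

Section Forms.
Variables (R : realType) (F0 : ptopologicalType) (t : BE_tower F0).
Variable mu : forall i, {measure set (borel (BE_F t i)) -> \bar R}.
Variable nu : forall i, probability (borel (BE_G t i)) R.
Variable mu_lim : {measure set (borel (BE_limit t)) -> \bar R}.

Definition BE_measures : Prop :=
  [/\ [/\ sigma_finite setT (mu 0%N), radon (mu 0%N) & full_support (mu 0%N)],
      forall i, radon (nu i) /\ full_support (nu i)
    & forall i (A : set (borel (BE_F t i.+1))), measurable A ->
        mu i.+1 A = (mu i \x nu i)%E (@BE_pi F0 t i @^-1` A)].

Definition BE_limit_measure : Prop :=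
  forall i (A : set (borel (BE_F t i))), measurable A ->
    mu_lim (@BE_Phi F0 t i @^-1` A) = mu i A.

Variable D : forall i, L2form (mu i).
Variable D_lim : L2form mu_lim.

Fixpoint BE_core (i : nat) : set (BE_F t i -> R) :=
  match i with
  | 0 => [set f | in_fdom (D 0%N) f /\ C0_fun (f : BE_F t 0%N -> R)]
  | j.+1 => [set f | C0_fun (f : BE_F t j.+1 -> R) /\
      exists n (fk : 'I_n -> BE_F t j -> R) (hk : 'I_n -> BE_G t j -> R),
        [/\ forall k, BE_core (fk k), forall k, continuous (hk k)
          & forall x g, f (BE_pi (x, g)) = \sum_(k < n) fk k x * hk k g]]
  end.

Definition BE_core_lim : set (BE_limit t -> R) :=
  [set f | exists i, exists2 u, @BE_core i u & f = u \o @BE_Phi F0 t i].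

(* The next two definitions say that a form is the completion of a given form
   on a given core: it extends the given form, its domain is complete for the
   norm fnorm, and the core is dense in the domain for this norm. *)
Definition BE_form_step (i : nat) : Prop :=
  [/\ closed_form (D i.+1), is_core (D i.+1) (@BE_core i.+1)
    & forall f h : BE_F t i.+1 -> R, BE_core f -> BE_core h ->
        fval (D i.+1) (toL2 (mu i.+1) f) (toL2 (mu i.+1) h) =
        \int[nu i]_g fval (D i) (toL2 (mu i) (fun x => f (BE_pi (x, g))))
                                (toL2 (mu i) (fun x => h (BE_pi (x, g))))].

Definition BE_form_limit : Prop :=
  [/\ closed_form D_lim, is_core D_lim BE_core_lim
    & forall i (u : BE_F t i -> R), BE_core u ->
        fval D_lim (toL2 mu_lim (u \o @BE_Phi F0 t i))
                   (toL2 mu_lim (u \o @BE_Phi F0 t i)) =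
        fval (D i) (toL2 (mu i) u) (toL2 (mu i) u)].

Definition BE_pullback (i : nat) (S : set (L2 (mu i))) : set (L2 mu_lim) :=
  [set f | exists2 u, S u & f = u \o @BE_Phi F0 t i %[ae mu_lim]].

Definition orth_part (i : nat) (S : set (L2 mu_lim)) : set (L2 mu_lim) :=
  [set f | BE_pullback (domL (D i)) f /\ forall g, S g -> L2dot f g = 0].

(* union of the spaces Dprime j for j < i *)
Fixpoint Dprime_below (i : nat) : set (L2 mu_lim) :=
  match i with
  | 0 => set0
  | j.+1 => Dprime_below j `|` orth_part j (Dprime_below j)
  end.

Definition Dprime (i : nat) : set (L2 mu_lim) := orth_part i (Dprime_below i).

End Forms.

Arguments Dprime {R F0 t mu} mu_lim D i.

(* Main.v *)
From HB Require Import structures.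
Require Import Defs.
From mathcomp Require Import all_boot all_order all_algebra.
From mathcomp Require Import all_classical all_reals all_analysis.
From mathcomp Require Import measurable_realfun ring lra.
Set Implicit Arguments.
Unset Strict Implicit.
Unset Printing Implicit Defensive.
Import Order.TTheory GRing.Theory Num.Theory.
Import numFieldNormedType.Exports.
Local Open Scope classical_set_scope.
Local Open Scope ring_scope.

(** Each stage of the Barlow-Evans sequence sits in the limit as a reducing
    subspace of the limit Laplacian, and the spectral projections of an
    operator preserve its reducing subspaces.

    _The stages are reducing._  Composition with Phi_i is an isometry J_i of
    L^2(F_i) into L^2(F_oo), and also of the form domains.  Let v belong to the
    core of E_(k+1).  Its average s over the fibres G_(k+1) satisfies both
    <u o phi, v> = <u, s> and E_(k+1)(u o phi, v) = E_k(u, s), the first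
    identity by Fubini and the second by the definition of E_(k+1)
    ([BE_average]).  Averaging level after level down to F_i, and then passing
    to limits with the completeness of the form on F_i, one gets for every v
    in the domain of E_oo an element P v of J_i(dom E_i) that is the orthogonal
    projection of v for the inner product and for the form at the same time
    ([BE_projection]).  Hence J_i maps Dom(Delta_i) into
    Dom(Delta_oo) and intertwines the two Laplacians ([laplacian_BE_comp],
    [laplacian_BE_compK]), and P commutes with Delta_oo ([laplacian_proj]).

    _Spectral projections preserve reducing subspaces._  This is proved without
    functional calculus.  The integral formula for A = Delta_oo first gives
    that A commutes with E_x ([laplacian_resol]), that the range of E_x lies in
    the domain, that |A f| <= x |f| on the range of E_x, which is 0 for
    x < 0, and that |A h| >= y |h| on the kernel of E_y.  For f in the range
    of E_x and y > x put h = (1 - E_y) P f.  As A commutes with P and E_y,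
    A^n h is the vector attached in the same way to A^n f, so that
    y^n |h| <= x^n |f| for all n ([proj_iter]) and h = 0.  Right continuity
    in y gives E_x P E_x = P E_x, and comparison with the adjoint identity
    gives P E_x = E_x P on the subspace ([reducing_resol]).

    _Conclusion._  E_x preserves J_i Dom(Delta_i) ([resol_pullback_domL]);
    being symmetric, it preserves by induction on i the orthogonal complement
    of the lower spaces, hence the i-th space ([resol_Dprime]).  This is the
    inclusion from right to left; the other one holds because a vector of the
    form E_x h is fixed by E_x. *)

(** * The inner product of L2 *)

Section InnerProduct.
Context d (T : measurableType d) (R : realType).
Variable mu : {measure set T -> \bar R}.
Implicit Types f g h : L2 mu.

Lemma integrable_L2M f g : mu.-integrable setT (EFin \o (fun x => f x * g x)).
Proof.
apply/Lfun1_integrable; apply: (@Lfun2_mul_Lfun1 _ _ _ mu f g); exact: LfunP.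
Qed.

Lemma L2dotC f g : L2dot f g = L2dot g f.
Proof. by apply: eq_Rintegral => x _; rewrite mulrC. Qed.

Lemma L2dot_linear a f g h : L2dot (a *: f + g) h = a * L2dot f h + L2dot g h.
Proof.
rewrite /L2dot.
rewrite (@eq_Rintegral _ _ _ _ _ (fun x => a * (f x * h x) + g x * h x));
  last by move=> x _ /=; rewrite mulrDl mulrA.
rewrite RintegralD//; last exact: integrable_L2M.
  rewrite RintegralZl//; exact: integrable_L2M.
apply: (@eq_integrable _ _ _ mu _ _ (fun x => a%:E * (f x * h x)%:E)%E) => //.
by apply: integrableZl => //; exact: integrable_L2M.
Qed.

Lemma L2dot_ge0 f : 0 <= L2dot f f.
Proof. by apply: Rintegral_ge0 => x _; rewrite -expr2 sqr_ge0. Qed.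

Lemma L2norm_sqr f : L2norm f ^+ 2 = L2dot f f.
Proof.
rewrite /L2norm /L2dot /Rintegral.
have Nfin : ('N[mu]_2[EFin \o f] \is a fin_num)%E.
  by rewrite -(finite_norm_fine f).
rewrite -powR_mulrn; last by rewrite fine_ge0// Lnorm_ge0.
rewrite -fine_poweR powR_Lnorm//.
congr fine; apply: eq_integral => x _ /=; rewrite powR_mulrn//.
by rewrite -normrX ger0_norm ?expr2// -expr2 sqr_ge0.
Qed.

Lemma L2norm_ge0 f : 0 <= L2norm f.
Proof. by rewrite fine_ge0// Lnorm_ge0. Qed.

Lemma L2norm_sqrt f : L2norm f = Num.sqrt (L2dot f f).
Proof. by rewrite -L2norm_sqr sqrtr_sqr ger0_norm// L2norm_ge0. Qed.

Lemma L2norm_eq0 f g : L2norm (f - g) = 0 -> f = g %[ae mu].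
Proof.
move=> /fine_Lnormr_eq0; apply: filterS => x /= fg0 _.
by apply/eqP; rewrite -subr_eq0; apply/eqP; exact: fg0.
Qed.

Lemma L2dot_ae f g h : f = g %[ae mu] -> L2dot f h = L2dot g h.
Proof.
move=> fg; rewrite /L2dot /Rintegral; congr fine.
apply: ae_eq_integral => //.
- by case/integrableP : (integrable_L2M f h).
- by case/integrableP : (integrable_L2M g h).
- by apply: filterS fg => x /= fgx _; rewrite fgx.
Qed.

Lemma L2norm_ae f g : f = g %[ae mu] -> L2norm f = L2norm g.
Proof.
by move=> fg; rewrite !L2norm_sqrt (L2dot_ae _ fg) L2dotC (L2dot_ae _ fg).
Qed.

End InnerProduct.

(** * Nonnegative symmetric forms *)

Section FormTheory.
Context d (T : measurableType d) (R : realType).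
Variable mu : {measure set T -> \bar R}.
Variable D : L2form mu.
Hypothesis hD : nonneg_symmetric_form D.
Implicit Types u v w : L2 mu.

Lemma fdomZ a u : fdom D u -> fdom D (a *: u).
Proof.
by move=> Du; rewrite -[_ *: _]addr0; apply: fdomP => //; exact: fdom0.
Qed.

Lemma fdomD u v : fdom D u -> fdom D v -> fdom D (u + v).
Proof. by move=> Du Dv; rewrite -[u]scale1r; exact: fdomP. Qed.

Lemma fdomB u v : fdom D u -> fdom D v -> fdom D (u - v).
Proof. by move=> Du Dv; rewrite addrC -scaleN1r; exact: fdomP. Qed.

Lemma fvalDl u v w : fdom D u -> fdom D v -> fdom D w ->
  fval D (u + v) w = fval D u w + fval D v w.
Proof.
by move=> Du Dv Dw; rewrite -[u in LHS]scale1r fval_linear// mul1r.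
Qed.

Lemma fvalBl u v w : fdom D u -> fdom D v -> fdom D w ->
  fval D (u - v) w = fval D u w - fval D v w.
Proof.
by move=> Du Dv Dw; rewrite addrC -scaleN1r fval_linear// mulN1r addrC.
Qed.

Lemma fval0l w : fdom D w -> fval D 0 w = 0.
Proof.
have D0 := fdom0 hD.
by move=> Dw; rewrite -[0](subrr 0) fvalBl// subrr.
Qed.

Lemma fvalZl a u w : fdom D u -> fdom D w -> fval D (a *: u) w = a * fval D u w.
Proof.
have D0 := fdom0 hD.
by move=> Du Dw; rewrite -[_ *: _]addr0 fval_linear// fval0l// addr0.
Qed.

Lemma fvalDr u v w : fdom D u -> fdom D v -> fdom D w ->
  fval D w (u + v) = fval D w u + fval D w v.
Proof.
move=> Du Dv Dw.
rewrite (fval_sym hD)//; last exact: fdomD.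
by rewrite fvalDl// !(fval_sym hD _ Dw).
Qed.

Lemma fvalBr u v w : fdom D u -> fdom D v -> fdom D w ->
  fval D w (u - v) = fval D w u - fval D w v.
Proof.
move=> Du Dv Dw.
rewrite (fval_sym hD)//; last exact: fdomB.
by rewrite fvalBl// !(fval_sym hD _ Dw).
Qed.

Lemma fvalZr a u w : fdom D u -> fdom D w -> fval D w (a *: u) = a * fval D w u.
Proof.
move=> Du Dw.
rewrite (fval_sym hD)//; last exact: fdomZ.
by rewrite fvalZl// !(fval_sym hD _ Dw).
Qed.

Lemma fval_ae2 u v u' v' : fdom D u -> fdom D v ->
  u = u' %[ae mu] -> v = v' %[ae mu] -> fval D u v = fval D u' v'.
Proof.
move=> Du Dv uu' vv'.
have Du' := fdom_ae hD Du uu'.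
rewrite (fval_ae hD Du Dv uu') (fval_sym hD)// (fval_ae hD Dv Du' vv').
by rewrite (fval_sym hD)//; exact: fdom_ae vv'.
Qed.

Lemma fval_CauchySchwarz u v : fdom D u -> fdom D v ->
  fval D u v ^+ 2 <= fval D u u * fval D v v.
Proof.
move=> Du Dv.
have uu := fval_ge0 hD Du; have vv := fval_ge0 hD Dv.
have key (a b : R) : 0 <= a ^+ 2 * fval D u u - 2 * (a * b) * fval D u v
    + b ^+ 2 * fval D v v.
  have Dau := fdomZ a Du; have Dbv := fdomZ b Dv.
  have := fval_ge0 hD (fdomB Dau Dbv).
  rewrite fvalBl// ?fvalBr//; try exact: fdomB.
  rewrite !fvalZl// !fvalZr// (fval_sym hD Dv Du).
  move=> /le_trans; apply; rewrite le_eqVlt; apply/orP; left.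
  by apply/eqP; ring.
(* If v has energy 0, the term in b^2 is absent and the choice
   a = fval u v, b = fval u u + 1 forces fval u v = 0. *)
have [b0|b0] := eqVneq (fval D v v) 0.
  have := key (fval D u v) (fval D u u + 1).
  by rewrite b0 !mulr0; nra.
have {}b0 : 0 < fval D v v by rewrite lt_neqAle eq_sym b0.
rewrite -subr_ge0 -(pmulr_rge0 _ b0).
apply: le_trans (key (fval D v v) (fval D u v)) _.
by rewrite le_eqVlt; apply/orP; left; apply/eqP; ring.
Qed.

Lemma fval_CauchySchwarz_sqrt u v : fdom D u -> fdom D v ->
  `|fval D u v| <= Num.sqrt (fval D u u) * Num.sqrt (fval D v v).
Proof.
move=> Du Dv; rewrite -sqrtrM ?(fval_ge0 hD)// -sqrtr_sqr ler_sqrt ?sqr_ge0//.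
  exact: fval_CauchySchwarz.
by rewrite mulr_ge0// (fval_ge0 hD).
Qed.

Lemma sqrt_fvalD u v : fdom D u -> fdom D v ->
  Num.sqrt (fval D (u + v) (u + v)) <=
  Num.sqrt (fval D u u) + Num.sqrt (fval D v v).
Proof.
move=> Du Dv; have Duv := fdomD Du Dv.
rewrite -(@ler_pXn2r _ 2)// ?nnegrE ?addr_ge0 ?sqrtr_ge0//.
rewrite sqr_sqrtr ?(fval_ge0 hD)// sqrrD !sqr_sqrtr ?(fval_ge0 hD)//.
rewrite fvalDl// !fvalDr// (fval_sym hD Dv Du).
have := fval_CauchySchwarz_sqrt Du Dv.
have := ler_norm (fval D u v).
lra.
Qed.

Lemma sqrt_fvalN u : fdom D u ->
  Num.sqrt (fval D (- u) (- u)) = Num.sqrt (fval D u u).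
Proof.
move=> Du; rewrite -scaleN1r; have := fdomZ (-1) Du => DNu.
by rewrite fvalZl// fvalZr//; congr Num.sqrt; ring.
Qed.

Lemma sqrt_fvalB u v : fdom D u -> fdom D v ->
  Num.sqrt (fval D (u - v) (u - v)) <=
  Num.sqrt (fval D u u) + Num.sqrt (fval D v v).
Proof.
move=> Du Dv; rewrite -(sqrt_fvalN Dv); apply: sqrt_fvalD => //.
by rewrite -scaleN1r; exact: fdomZ.
Qed.

End FormTheory.

Section DotForm.
Context d (T : measurableType d) (R : realType).
Variable mu : {measure set T -> \bar R}.
Implicit Types u v w f g h : L2 mu.

(** The inner product is a nonnegative symmetric form defined everywhere, so
    that Cauchy-Schwarz and the triangle inequality need only be proved for
    forms. *)
Definition dot_form : L2form mu := MkL2form setT (@L2dot _ _ _ mu).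

Lemma dot_form_nonneg : nonneg_symmetric_form dot_form.
Proof.
split => //=; first by move=> u v w _ _; exact: L2dot_ae.
- by move=> a u v w _ _ _; exact: L2dot_linear.
- by move=> u v _ _; exact: L2dotC.
- by move=> u _; exact: L2dot_ge0.
Qed.

Let DN := dot_form_nonneg.

Lemma L2dotDl u v w : L2dot (u + v) w = L2dot u w + L2dot v w.
Proof. exact: (fvalDl DN). Qed.
Lemma L2dotBl u v w : L2dot (u - v) w = L2dot u w - L2dot v w.
Proof. exact: (fvalBl DN). Qed.
Lemma L2dotDr u v w : L2dot w (u + v) = L2dot w u + L2dot w v.
Proof. exact: (fvalDr DN). Qed.
Lemma L2dotBr u v w : L2dot w (u - v) = L2dot w u - L2dot w v.
Proof. exact: (fvalBr DN). Qed.
Lemma L2dot_aer f g h : f = g %[ae mu] -> L2dot h f = L2dot h g.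
Proof. by move=> fg; rewrite L2dotC (L2dot_ae _ fg) L2dotC. Qed.

Lemma L2dot_CauchySchwarz u v : `|L2dot u v| <= L2norm u * L2norm v.
Proof.
by rewrite !L2norm_sqrt; exact: (fval_CauchySchwarz_sqrt DN).
Qed.

Lemma L2normD u v : L2norm (u + v) <= L2norm u + L2norm v.
Proof. by rewrite !L2norm_sqrt; exact: (sqrt_fvalD DN). Qed.

Lemma L2normN u : L2norm (- u) = L2norm u.
Proof. by rewrite !L2norm_sqrt; exact: (sqrt_fvalN DN). Qed.

Lemma L2norm_distC u v : L2norm (u - v) = L2norm (v - u).
Proof. by rewrite -L2normN opprB. Qed.

Lemma L2dot_eq0 f g : (forall h, L2dot f h = L2dot g h) -> f = g %[ae mu].
Proof.
move=> fg; apply: L2norm_eq0; apply/eqP.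
by rewrite -sqrf_eq0 L2norm_sqr L2dotBl fg subrr.
Qed.

Lemma aeD f g f' g' : f = f' %[ae mu] -> g = g' %[ae mu] ->
  f + g = f' + g' %[ae mu].
Proof.
apply: filterS2 => x hf hg _; move: (hf I) (hg I) => /= {}hf {}hg.
by change (f x + g x = f' x + g' x); rewrite hf hg.
Qed.

Lemma aeB f g f' g' : f = f' %[ae mu] -> g = g' %[ae mu] ->
  f - g = f' - g' %[ae mu].
Proof.
apply: filterS2 => x hf hg _; move: (hf I) (hg I) => /= {}hf {}hg.
by change (f x - g x = f' x - g' x); rewrite hf hg.
Qed.

End DotForm.

(** * Lebesgue-Stieltjes measures of finite mass *)

Section Stieltjes.
Variable R : realType.
Implicit Types m : cumulative R R.
Local Notation LS := lebesgue_stieltjes_measure.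

Lemma lsm_itv m (a b : R) : a <= b -> LS m `]a, b]%classic = (m b - m a)%:E.
Proof.
move=> ab; rewrite /lebesgue_stieltjes_measure /measure_extension.
rewrite measurable_mu_extE/=; last exact: is_ocitv.
by rewrite wlength_itv_bnd.
Qed.

Lemma lsm_setT m c : m @ -oo --> (0 : R) -> m @ +oo --> c -> LS m setT = c%:E.
Proof.
move=> mNy my; pose I n : set (measurableTypeR R) := `]- (n%:R), n%:R]%classic.
have mI n : measurable (I n) by exact: measurable_itv.
have cupI : \bigcup_n I n = setT by exact: (bigcup_itvT false false).
have ndI : nondecreasing_seq I.
  move=> k n kn; apply/subsetPset => x; rewrite /I/= !in_itv/= => /andP[kx xk].
  by rewrite (le_lt_trans _ kx) ?lerN2 ?ler_nat// (le_trans xk) ?ler_nat.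
have mcup := bigcup_measurable (fun n (_ : setT n) => mI n).
have := nondecreasing_cvg_mu (mu := LS m) mI mcup ndI.
rewrite cupI => cvI; apply: (cvg_unique _ cvI) => //.
have -> : LS m \o I = fun n => (m n%:R - m (- n%:R))%:E.
  by apply/funext => n; rewrite /= lsm_itv// ge0_cp.
apply: cvg_EFin; first exact: nearW.
rewrite -(subr0 c); apply: cvgB; first exact: (cvg_comp _ _ (@cvgr_idn R) my).
apply: (cvg_comp (fun n : nat => - n%:R) m _ mNy).
exact/cvgNrNy/cvgr_idn.
Qed.

Lemma lsm_bigcup0 m (a b : R ^nat) : (forall n, a n <= b n) ->
  (forall n, m (a n) = m (b n)) -> LS m (\bigcup_n `]a n, b n]%classic) = 0%E.
Proof.
move=> ab mab; apply/eqP; rewrite eq_le measure_ge0 andbT.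
have mI n : measurable (`]a n, b n]%classic : set (measurableTypeR R)).
  exact: measurable_itv.
apply: (le_trans (measure_sigma_subadditive (LS m) mI _ (@subset_refl _ _))).
  exact: bigcup_measurable.
by rewrite eseries0// => n _ _; rewrite /= lsm_itv// mab subrr.
Qed.

Lemma lsm_above0 m a : (forall x, a <= x -> m x = m a) ->
  LS m `]a, +oo[%classic = 0%E.
Proof.
move=> ma; rewrite itv_bndy_bigcup_BRight.
apply: (@lsm_bigcup0 m (fun=> a) (fun n => a + n%:R)) => n.
  by rewrite lerDl.
by rewrite ma// lerDl.
Qed.

Lemma lsm_below0 m a : (forall x, x <= a -> m x = m a) ->
  LS m `]-oo, a]%classic = 0%E.
Proof.
move=> ma.
have -> : `]-oo, a]%classic = \bigcup_n `]a - n%:R, a]%classic.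
  apply/seteqP; split=> x /=; rewrite !in_itv/=.
    move=> xa; exists (Num.bound (a - x)) => //=; rewrite in_itv/= xa andbT.
    by rewrite ltrBlDr -ltrBlDl archi_boundP// subr_ge0.
  by move=> [n _] /=; rewrite in_itv/= => /andP[].
apply: (@lsm_bigcup0 m (fun n => a - n%:R) (fun=> a)) => n.
  by rewrite gerBl.
by rewrite ma// gerBl.
Qed.

Lemma lsm_add m m1 m2 : (forall x, m x = m1 x + m2 x) ->
  forall A, measurable A -> LS m A = (LS m1 A + LS m2 A)%E.
Proof.
move=> mE A mA.
rewrite -(measure_addE (LS m1) (LS m2)).
apply: lebesgue_stieltjes_measure_unique => //.
move=> X /ocitvP[->|[[a b] /= ab ->]].
  by rewrite !(measure0 (LS m)) (measure0 (measure_add (LS m1) (LS m2))).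
transitivity (LS m1 `]a, b]%classic + LS m2 `]a, b]%classic)%E; last first.
  by rewrite -(measure_addE (LS m1) (LS m2)).
rewrite !lsm_itv ?ltW// -EFinD !mE; congr EFin; ring.
Qed.

Lemma measurable_lsm_id D m :
  measurable_fun D (fun x : measurableTypeR R => x : R).
Proof. by move=> mD A mA; exact: measurableI. Qed.

Lemma lsm_add_integral_sqr m m1 m2 : (forall x, m x = m1 x + m2 x) ->
  (\int[LS m]_x (x ^+ 2)%:E =
   \int[LS m1]_x (x ^+ 2)%:E + \int[LS m2]_x (x ^+ 2)%:E)%E.
Proof.
move=> mE; rewrite -ge0_integral_measure_add//.
- apply: eq_measure_integral => A mA _; rewrite [RHS]measure_addE.
  exact: lsm_add.
- by move=> x _; rewrite lee_fin sqr_ge0.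
- apply/measurable_EFinP; apply: measurable_funX; exact: measurable_lsm_id.
Qed.

Lemma lsm_add_Rintegral_id m m1 m2 : (forall x, m x = m1 x + m2 x) ->
  (LS m1).-integrable setT (fun x => x%:E) ->
  (LS m2).-integrable setT (fun x => x%:E) ->
  \int[LS m]_x x = \int[LS m1]_x x + \int[LS m2]_x x.
Proof.
move=> mE i1 i2; rewrite /Rintegral -fineD; [|exact: integrable_fin_num..].
rewrite -integral_measure_add//.
congr fine; apply: eq_measure_integral => A mA _; rewrite [RHS]measure_addE.
exact: lsm_add.
Qed.

Section finite_mass.
Variables (m : cumulative R R) (c : R).
Hypothesis mT : LS m setT = c%:E.

Lemma lsm_integrable_cst (D : set (measurableTypeR R)) k : measurable D ->
  (LS m).-integrable D (fun=> (k : R)%:E).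
Proof.
move=> mD; apply/integrableP; split; first exact: measurable_cst.
rewrite integral_cst//= lte_mul_pinfty//.
apply: (@le_lt_trans _ _ (LS m setT)); last by rewrite mT ltry.
by apply: le_measure; rewrite ?inE.
Qed.

Lemma lsm_Rintegral_cst k : \int[LS m]_x k = k * c.
Proof.
rewrite /Rintegral integral_cst//.
by transitivity (fine (k%:E * LS m setT)%E) => //; rewrite mT.
Qed.

Lemma lsm_Rintegral_setD (N : set (measurableTypeR R)) (f : R -> R) :
  measurable N -> LS m N = 0%E -> (LS m).-integrable setT (EFin \o f) ->
  \int[LS m]_x f x = \int[LS m]_(x in setT `\` N) f x.
Proof.
by move=> mN N0 fi; rewrite /Rintegral (negligible_integral mN).
Qed.

(** |x| <= 1 + x^2, and constants are integrable for a finite measure. *)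
Lemma lsm_integrable_id : (\int[LS m]_x (x ^+ 2)%:E < +oo)%E ->
  (LS m).-integrable setT (fun x => x%:E).
Proof.
move=> x2oo.
have mid := @measurable_lsm_id setT m.
have i1 := lsm_integrable_cst (1 : R) (@measurableT _ (measurableTypeR R)).
have i2 : (LS m).-integrable setT (fun x : R => (x ^+ 2)%:E).
  apply/integrableP; split.
    by apply/measurable_EFinP; apply: measurable_funX.
  by under eq_integral do rewrite gee0_abs ?lee_fin ?sqr_ge0//.
have i3 := integrableD (@measurableT _ (measurableTypeR R)) i1 i2.
apply: le_integrable i3 => //; first exact/measurable_EFinP.
move=> x _ /=; rewrite -?EFinD lee_fin [leRHS]ger0_norm ?addr_ge0 ?sqr_ge0//.
have [x0|x0] := leP 0 x; [rewrite ger0_norm//|rewrite ltr0_norm//]; nra.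
Qed.

Lemma lsm_int_le a : (LS m).-integrable setT (fun x => x%:E) ->
  (forall x, a <= x -> m x = m a) -> \int[LS m]_x x <= a * c.
Proof.
move=> iid ma.
have N0 := lsm_above0 ma.
have mN : measurable (`]a, +oo[%classic : set (measurableTypeR R)).
  exact: measurable_itv.
rewrite -lsm_Rintegral_cst.
rewrite (lsm_Rintegral_setD mN N0 iid).
rewrite (lsm_Rintegral_setD (f := cst a) mN N0);
  last exact: (lsm_integrable_cst a).
apply: le_Rintegral.
- exact: measurableD.
- by apply: integrableS iid => //; exact: measurableD.
- by apply: (lsm_integrable_cst a); exact: measurableD.
- by move=> x [_] /=; rewrite in_itv/= andbT => /negP; rewrite -leNgt.
Qed.

Lemma lsm_int_ge a : (LS m).-integrable setT (fun x => x%:E) ->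
  (forall x, x <= a -> m x = m a) -> a * c <= \int[LS m]_x x.
Proof.
move=> iid ma.
have N0 := lsm_below0 ma.
have mN : measurable (`]-oo, a]%classic : set (measurableTypeR R)).
  exact: measurable_itv.
rewrite -lsm_Rintegral_cst.
rewrite (lsm_Rintegral_setD mN N0 iid).
rewrite (lsm_Rintegral_setD (f := cst a) mN N0);
  last exact: (lsm_integrable_cst a).
apply: le_Rintegral.
- exact: measurableD.
- by apply: (lsm_integrable_cst a); exact: measurableD.
- by apply: integrableS iid => //; exact: measurableD.
- by move=> x [_] /=; rewrite in_itv/= => /negP; rewrite -ltNge => /ltW.
Qed.

(** The measure is carried by ]a, b], where x^2 <= a^2 + b^2. *)
Lemma lsm_sqr_lty a b : (forall x, x <= a -> m x = m a) ->
  (forall x, b <= x -> m x = m b) -> (\int[LS m]_x (x ^+ 2)%:E < +oo)%E.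
Proof.
move=> ma mb.
have mid := @measurable_lsm_id setT m.
pose N := (`]-oo, a] `|` `]b, +oo[)%classic : set (measurableTypeR R).
have mN : measurable N by apply: measurableU; exact: measurable_itv.
have N0 : LS m N = 0%E.
  rewrite -(lsm_below0 ma); apply: measureU0; last exact: lsm_above0.
    exact: measurable_itv.
  exact: measurable_itv.
rewrite (ge0_negligible_integral mN)//=; last 2 first.
- by apply/measurable_EFinP; apply: measurable_funX.
- by move=> x _; rewrite lee_fin sqr_ge0.
have mTN : measurable (setT `\` N) by exact: measurableD.
apply: (@le_lt_trans _ _ (\int[LS m]_(x in setT `\` N) (a ^+ 2 + b ^+ 2)%:E)%E).
  apply: ge0_le_integral => //.
  - by move=> x _; rewrite lee_fin sqr_ge0.
  - by apply/measurable_EFinP; apply: measurable_funS mTN _ _ => //.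
  - move=> x [_] /=; rewrite /N /= !in_itv/= andbT => /not_orP[/negP + /negP].
    rewrite lee_fin -ltNge -leNgt => ax xb.
    by have [x0|x0] := leP 0 x; nra.
by apply: integrable_lty => //; exact: lsm_integrable_cst.
Qed.

End finite_mass.
End Stieltjes.

(** * The generator of a form *)

Section Generator.
Context d (T : measurableType d) (R : realType).
Variable mu : {measure set T -> \bar R}.
Variable D : L2form mu.
Hypothesis hD : nonneg_symmetric_form D.
Implicit Types f g h k : L2 mu.

Lemma aeq_refl f : f = f %[ae mu].
Proof. exact: ae_eq_refl. Qed.

Lemma aeq_sym f g : f = g %[ae mu] -> g = f %[ae mu].
Proof. exact: ae_eq_sym. Qed.

Lemma aeq_trans f g h : f = g %[ae mu] -> g = h %[ae mu] -> f = h %[ae mu].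
Proof. exact: ae_eq_trans. Qed.

Lemma L2norm_sub_ae f g : f = g %[ae mu] -> L2norm (f - g) = 0.
Proof.
move=> fg; rewrite L2norm_sqrt L2dotBl.
by rewrite (L2dot_ae _ fg) subrr sqrtr0.
Qed.

Lemma laplacian_ae f k f' k' : f = f' %[ae mu] -> k = k' %[ae mu] ->
  laplacian D f k -> laplacian D f' k'.
Proof.
move=> ff' kk' [Df fk]; split; first exact: fdom_ae ff'.
by move=> v Dv; rewrite -(fval_ae hD Df Dv ff') fk// (L2dot_ae _ kk').
Qed.

Lemma laplacianB f k f' k' : laplacian D f k -> laplacian D f' k' ->
  laplacian D (f - f') (k - k').
Proof.
move=> [Df fk] [Df' fk']; split; first exact: fdomB.
by move=> v Dv; rewrite fvalBl// fk// fk'// L2dotBl.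
Qed.

Lemma laplacianD f k f' k' : laplacian D f k -> laplacian D f' k' ->
  laplacian D (f + f') (k + k').
Proof.
move=> [Df fk] [Df' fk']; split; first exact: fdomD.
by move=> v Dv; rewrite fvalDl// fk// fk'// L2dotDl.
Qed.

Lemma laplacian_sym f k g l : laplacian D f k -> laplacian D g l ->
  L2dot k g = L2dot f l.
Proof.
by move=> [Df fk] [Dg gl]; rewrite -fk// (fval_sym hD)// gl// L2dotC.
Qed.

Lemma domLD f g : domL D f -> domL D g -> domL D (f + g).
Proof. by move=> [k fk] [l gl]; exists (k + l); exact: laplacianD. Qed.

Lemma domL_ae f g : f = g %[ae mu] -> domL D f -> domL D g.
Proof. by move=> fg [k fk]; exists k; exact: laplacian_ae (aeq_refl k) fk. Qed.

Lemma domL_fdom f : domL D f -> fdom D f.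
Proof. by case=> k []. Qed.

End Generator.

(** * Spectral measures *)

Section Resolution.
Context d (T : measurableType d) (R : realType).
Variable mu : {measure set T -> \bar R}.
Variable D : L2form mu.
Hypothesis hD : nonneg_symmetric_form D.
Variable E : R -> L2 mu -> L2 mu.
Hypothesis hE : spectral_resolution (laplacian D) E.
Implicit Types f g h k : L2 mu.
Local Notation LS := lebesgue_stieltjes_measure.

Lemma resolB x f g : E x (f - g) = (E x f - E x g : L2 mu) %[ae mu].
Proof.
have := resol_linear hE x (-1) g f.
by rewrite !scaleN1r (addrC (- g)) (addrC (- E x g)).
Qed.

Lemma resolD x f g : E x (f + g) = (E x f + E x g : L2 mu) %[ae mu].
Proof.
have := resol_linear hE x 1 f g.
by rewrite !scale1r.
Qed.

Lemma resol0 x : E x 0 = (0 : L2 mu) %[ae mu].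
Proof. by have := resolB x 0 0; rewrite !subrr. Qed.

Lemma resol_idem x f : E x (E x f) = E x f %[ae mu].
Proof. by have := resol_min hE x x f; rewrite minxx. Qed.

Lemma resol_ran_le x y f : x <= y -> E x f = f %[ae mu] -> E y f = f %[ae mu].
Proof.
move=> xy xf.
apply: (aeq_trans (aeq_trans (resol_ae hE y (aeq_sym xf)) _) xf).
by have := resol_min hE y x f; rewrite min_r.
Qed.

Lemma resol_ker_le x y f : x <= y -> E y f = (0 : L2 mu) %[ae mu] ->
  E x f = (0 : L2 mu) %[ae mu].
Proof.
move=> xy yf0.
have := resol_min hE x y f; rewrite min_l// => /aeq_sym xyf.
apply: (aeq_trans xyf); apply: (aeq_trans _ (resol0 x)).
exact: (resol_ae hE).
Qed.

Lemma resol_ker_compl x f : E x (f - E x f) = (0 : L2 mu) %[ae mu].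
Proof.
apply: (aeq_trans (resolB x f (E x f))).
rewrite -(subrr (E x f)); apply: aeB; first exact: aeq_refl.
exact: resol_idem.
Qed.

Lemma dot_resol x f : L2dot (E x f) (E x f) = L2dot (E x f) f.
Proof.
by rewrite (resol_sym hE) (L2dot_aer _ (resol_idem x f)) -(resol_sym hE).
Qed.

(** The limits of E at -oo and +oo give the total mass |f|^2.  It is finite, so
    the function x is integrable as soon as x^2 is. *)
Lemma spectral_measure f : exists m : cumulative R R,
  [/\ forall x, m x = L2dot (E x f) f,
      LS m setT = (L2dot f f)%:E,
      domL D f <-> (\int[LS m]_x (x ^+ 2)%:E < +oo)%E &
      forall k, laplacian D f k -> L2dot k f = \int[LS m]_x x].
Proof.
have [m [mE mdom mint]] := resol_integral hE f.
exists m; split=> //.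
apply: lsm_setT.
- apply/cvgrPdist_le => /= e e0.
  have := resol_ninfty hE f => /cvgrPdist_le /=.
  have e1 : 0 < e / (L2norm f + 1).
    by rewrite divr_gt0// ltr_wpDl// L2norm_ge0.
  move=> /(_ _ e1); apply: filterS => y.
  rewrite !sub0r !normrN mE => ye.
  apply: le_trans (L2dot_CauchySchwarz _ _) _.
  rewrite ger0_norm ?L2norm_ge0// in ye.
  move: ye; rewrite ler_pdivlMr; last by rewrite ltr_wpDl// L2norm_ge0.
  by have := L2norm_ge0 (E y f); have := L2norm_ge0 f; nra.
- apply/cvgrPdist_le => /= e e0.
  have := resol_pinfty hE f => /cvgrPdist_le /=.
  have e1 : 0 < e / (L2norm f + 1).
    by rewrite divr_gt0// ltr_wpDl// L2norm_ge0.
  move=> /(_ _ e1); apply: filterS => y.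
  rewrite !sub0r !normrN mE -L2dotBl => ye.
  apply: le_trans (L2dot_CauchySchwarz _ _) _.
  rewrite ger0_norm ?L2norm_ge0// in ye.
  move: ye; rewrite ler_pdivlMr; last by rewrite ltr_wpDl// L2norm_ge0.
  by have := L2norm_ge0 (f - E y f); have := L2norm_ge0 f; nra.
Qed.

(** The spectral measure of f does not charge ]b, +oo[. *)
Lemma resol_le_sup b f k : laplacian D f k -> E b f = f %[ae mu] ->
  L2dot k f <= b * L2dot f f.
Proof.
move=> fk fb; have [m [mE mT mdom mint]] := spectral_measure f.
rewrite (mint _ fk).
apply: (lsm_int_le mT).
  by apply: (lsm_integrable_id mT); apply/mdom; exists k.
move=> x bx; rewrite !mE (L2dot_ae _ fb).
by apply: L2dot_ae; exact: (resol_ran_le _ fb).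
Qed.

(** The spectral measure of f does not charge ]-oo, a]. *)
Lemma resol_ge_inf a f k : laplacian D f k -> E a f = (0 : L2 mu) %[ae mu] ->
  a * L2dot f f <= L2dot k f.
Proof.
move=> fk fa; have [m [mE mT mdom mint]] := spectral_measure f.
rewrite (mint _ fk).
apply: (lsm_int_ge mT).
  by apply: (lsm_integrable_id mT); apply/mdom; exists k.
move=> x xa; rewrite !mE (L2dot_ae _ fa).
by apply: L2dot_ae; exact: (resol_ker_le _ fa).
Qed.

(** The spectral measure of f is carried by the bounded interval ]a, b]. *)
Lemma resol_block_domL a b f : E a f = (0 : L2 mu) %[ae mu] ->
  E b f = f %[ae mu] -> domL D f.
Proof.
move=> fa fb; have [m [mE mT mdom _]] := spectral_measure f.
apply/mdom; apply: (@lsm_sqr_lty _ _ _ mT a b).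
- move=> x xa; rewrite !mE (L2dot_ae _ fa).
  by apply: L2dot_ae; exact: (resol_ker_le _ fa).
- move=> x bx; rewrite !mE (L2dot_ae _ fb).
  by apply: L2dot_ae; exact: (resol_ran_le _ fb).
Qed.

Lemma resol_block a b f : a <= b ->
  E a (E b f - E a (E b f)) = (0 : L2 mu) %[ae mu] /\
  E b (E b f - E a (E b f)) = (E b f - E a (E b f) : L2 mu) %[ae mu].
Proof.
move=> ab; split; first exact: resol_ker_compl.
apply: (aeq_trans (resolB _ _ _)); apply: aeB; first exact: resol_idem.
by have := resol_min hE b a (E b f); rewrite min_r.
Qed.

(** Cut off f to the spectral block ]a, b], with a and b near -oo and +oo. *)
Lemma domL_dense f e : 0 < e -> exists2 g, domL D g & L2norm (f - g) < e.
Proof.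
move=> e0; have e2 : 0 < e / 2 by rewrite divr_gt0.
have : \forall y \near +oo, L2norm (f - E y f) < e / 2 /\ 0 <= y.
  near=> y; split; last by near: y; exact: nbhs_pinfty_ge.
  rewrite -[X in X < _]ger0_norm ?L2norm_ge0// -normrN -sub0r.
  near: y; exact: (@cvgr_dist_lt _ _ _ _ _ _ _ (resol_pinfty hE f)).
case/filter_ex => b [fb b0].
have : \forall y \near -oo, L2norm (E y (E b f)) < e / 2 /\ y <= 0.
  near=> y; split; last by near: y; exact: nbhs_ninfty_le.
  rewrite -[X in X < _]ger0_norm ?L2norm_ge0// -normrN -sub0r.
  near: y; exact: (@cvgr_dist_lt _ _ _ _ _ _ _ (resol_ninfty hE _)).
case/filter_ex => a [fa a0].
have [ha hb] := @resol_block a b f (le_trans a0 b0).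
exists (E b f - E a (E b f)); first exact: resol_block_domL ha hb.
rewrite opprB addrCA addrC; apply: le_lt_trans (L2normD _ _) _.
by rewrite (splitr e) ltrD.
Unshelve. all: by end_near. Qed.

End Resolution.

(** * The generator commutes with its spectral projections *)

Section Commutation.
Context d (T : measurableType d) (R : realType).
Variable mu : {measure set T -> \bar R}.
Variable D : L2form mu.
Hypothesis hD : nonneg_symmetric_form D.
Variable E : R -> L2 mu -> L2 mu.
Hypothesis hE : spectral_resolution (laplacian D) E.
Implicit Types f g h k : L2 mu.
Local Notation LS := lebesgue_stieltjes_measure.

Lemma dot_domL_eq f g : (forall h, domL D h -> L2dot f h = L2dot g h) ->
  f = g %[ae mu].
Proof.
move=> fg; apply: L2dot_eq0 => h; apply/eqP; rewrite -subr_eq0 -L2dotBl.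
rewrite -normr_le0; apply/ler_addgt0Pl => e e0; rewrite addr0.
set u := f - g.
have n1 : 0 < L2norm u + 1 by rewrite ltr_wpDl// L2norm_ge0.
have [w Dw hw] := domL_dense hE h (divr_gt0 e0 n1).
have -> : L2dot u h = L2dot u (h - w).
  by rewrite [RHS]L2dotBr [X in _ - X]L2dotBl fg// subrr subr0.
apply: le_trans (L2dot_CauchySchwarz _ _) _.
move: hw; rewrite ltr_pdivlMr//.
by have := L2norm_ge0 u; have := L2norm_ge0 (h - w); nra.
Qed.

(** Every E_x keeps the two components E_l f and f - E_l f orthogonal to each
    other, so the spectral measure of f is the sum of theirs. *)
Lemma dot_resol_split x l f : L2dot (E x f) f =
  L2dot (E x (E l f)) (E l f) + L2dot (E x (f - E l f)) (f - E l f).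
Proof.
pose p := Num.min x l.
have Ep : E x (E l f) = E p f %[ae mu] := resol_min hE x l f.
have e1 : L2dot (E x (E l f)) (E l f) = L2dot (E p f) f.
  rewrite -(resol_sym hE) (L2dot_ae _ (resol_ae hE l Ep)).
  by rewrite (L2dot_ae _ (resol_min hE l p f)) min_r// ge_min lexx orbT.
have e2 : L2dot (E x (f - E l f)) (E l f) = 0.
  rewrite -(resol_sym hE) (L2dot_ae _ (resol_min hE l x _)) minC -/p.
  rewrite (L2dot_ae _ (resolB hE p f (E l f))) L2dotBl.
  rewrite (L2dot_ae _ (resol_min hE p l f)) min_l ?subrr//.
  by rewrite ge_min lexx orbT.
rewrite e1 L2dotBr e2 subr0 (L2dot_ae _ (resolB hE x f (E l f))) L2dotBl.
by rewrite (L2dot_ae _ Ep) addrC subrK.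
Qed.

Lemma resol_domL_compl l f : domL D f -> domL D (E l f) /\ domL D (f - E l f).
Proof.
move=> fD.
have [m [mE mT mdom _]] := spectral_measure hE f.
have [m1 [m1E m1T m1dom _]] := spectral_measure hE (E l f).
have [m2 [m2E m2T m2dom _]] := spectral_measure hE (f - E l f).
have m12 := lsm_add_integral_sqr (m := m) (m1 := m1) (m2 := m2) _.
have i1 : (0 <= \int[LS m1]_x (x ^+ 2)%:E)%E.
  by apply: integral_ge0 => x _; rewrite lee_fin sqr_ge0.
have i2 : (0 <= \int[LS m2]_x (x ^+ 2)%:E)%E.
  by apply: integral_ge0 => x _; rewrite lee_fin sqr_ge0.
move/mdom : fD; rewrite m12; last first.
  by move=> x; rewrite mE m1E m2E; exact: dot_resol_split.
move=> lt12.
split; [apply/m1dom|apply/m2dom]; apply: le_lt_trans lt12.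
  exact: leeDl i2.
exact: leeDr i1.
Qed.

Lemma resol_domL l f : domL D f -> domL D (E l f).
Proof. by case/(resol_domL_compl l). Qed.

(** Let A be the generator, g = E_l f and h = f - g.  Integrating x against the
    decomposition of the spectral measure gives <A f, f> = <A g, g> + <A h, h>,
    whence the cross term 2 <A g, h> vanishes. *)
Lemma fval_resol_compl l f : domL D f -> fval D (E l f) (f - E l f) = 0.
Proof.
have add_eq0 (a b c : R) : b + a + (a + c) = b + c -> a = 0 by lra.
move=> fD; have [[kg gkg] [kh hkh]] := resol_domL_compl l fD.
have [m [mE mT mdom mint]] := spectral_measure hE f.
have [m1 [m1E m1T m1dom m1int]] := spectral_measure hE (E l f).
have [m2 [m2E m2T m2dom m2int]] := spectral_measure hE (f - E l f).
have fk : laplacian D f (kg + kh).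
  apply: laplacian_ae (laplacianD hD gkg hkh) => //.
    by rewrite addrC subrK; exact: aeq_refl.
  exact: aeq_refl.
have i1 : (LS m1).-integrable setT (fun x => x%:E).
  by apply: (lsm_integrable_id m1T); apply/m1dom; exists kg.
have i2 : (LS m2).-integrable setT (fun x => x%:E).
  by apply: (lsm_integrable_id m2T); apply/m2dom; exists kh.
have intE : \int[LS m]_x x = \int[LS m1]_x x + \int[LS m2]_x x.
  apply: lsm_add_Rintegral_id => // x; rewrite mE m1E m2E.
  exact: dot_resol_split.
have := mint _ fk; rewrite intE -(m1int _ gkg) -(m2int _ hkh).
have fE : f = E l f + (f - E l f) by rewrite addrC subrK.
rewrite [X in L2dot _ X = _]fE.
move: (f - E l f) hkh => g hkh; rewrite !L2dotDl !L2dotDr.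
have := laplacian_sym hD hkh gkg; rewrite [RHS]L2dotC => ->.
rewrite -(proj2 gkg _ (proj1 hkh)).
exact: add_eq0.
Qed.

(** Polarization of [fval_resol_compl], applied to E_l f + g: the component of
    E_l f outside the range of E_l is zero, so only one cross term remains. *)
Lemma fval_resol_orth l f g : domL D f -> domL D g ->
  fval D (E l f) (g - E l g) = 0.
Proof.
move=> fD gD; have [FD F'D] := resol_domL_compl l fD.
have [GD G'D] := resol_domL_compl l gD.
have [Ff Fg] := (domL_fdom FD, domL_fdom F'D).
have [Gf Gg] := (domL_fdom GD, domL_fdom G'D).
have := fval_resol_compl l (domLD hD FD gD).
have e1 : E l (E l f + g) = (E l f + E l g : L2 mu) %[ae mu].
  apply: (aeq_trans (resolD hE _ _ _)).
  apply: aeD; first exact: (resol_idem hE).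
  exact: aeq_refl.
have e2 : (E l f + g) - E l (E l f + g) = (g - E l g : L2 mu) %[ae mu].
  have := aeB (aeq_refl (E l f + g)) e1.
  by rewrite opprD addrACA subrr add0r.
have D1 : fdom D (E l (E l f + g)).
  by apply: domL_fdom; apply: resol_domL; apply: domLD.
rewrite (fval_ae2 hD D1 _ e1 e2); last first.
  apply: fdomB => //; apply: domL_fdom; exact: domLD.
by rewrite fvalDl// (fval_resol_compl l gD) addr0.
Qed.

(** By [fval_resol_orth], fval (E_l f) g = fval f (E_l g) for g in the dense
    set Dom(A), and E_l is symmetric. *)
Lemma laplacian_resol l f k : laplacian D f k -> laplacian D (E l f) (E l k).
Proof.
move=> fk; have fD : domL D f by exists k.
have [kg gkg] := resol_domL l fD.
suff kgE : kg = E l k %[ae mu] by exact: (laplacian_ae hD (aeq_refl _) kgE gkg).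
apply: (@dot_domL_eq kg (E l k)) => g gD.
have gD' := resol_domL l gD; have [l' gl'] := gD.
rewrite -(proj2 gkg _ (domL_fdom gD)) (resol_sym hE).
rewrite -(proj2 fk _ (domL_fdom gD')).
have h1 := fval_resol_orth l fD gD.
have h2 := fval_resol_orth l gD fD.
move: h1 h2; rewrite !fvalBr//;
  do ?[exact: domL_fdom|exact: (domL_fdom (resol_domL _ _))].
rewrite (fval_sym hD (domL_fdom gD') (domL_fdom fD)).
rewrite (fval_sym hD (domL_fdom gD') (domL_fdom (resol_domL l fD))).
by move=> /eqP; rewrite subr_eq0 => /eqP -> /eqP; rewrite subr_eq0 => /eqP ->.
Qed.

(** For n <= l < 0 the vector g = E_l f - E_n (E_l f) lies in the domain and
    0 <= <A g, g> <= l |g|^2, so g = 0; then n tends to -oo. *)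
Lemma resol_lt0 l f : l < 0 -> E l f = (0 : L2 mu) %[ae mu].
Proof.
move=> l0; apply: L2norm_eq0; rewrite subr0.
have key n : n <= l -> L2norm (E l f) <= L2norm (E n (E l f)).
  move=> nl; have [h1 h2] := resol_block hE f nl.
  set g := _ - _ in h1 h2.
  have [k gk] := resol_block_domL hE h1 h2.
  have g0 : L2norm g = 0.
    have := resol_le_sup hE gk h2; rewrite -(proj2 gk _ (proj1 gk)).
    move=> /(le_trans (fval_ge0 hD (proj1 gk))).
    rewrite nmulr_rge0// -L2norm_sqr => n0.
    by apply/eqP; rewrite -sqrf_eq0 eq_le n0 sqr_ge0.
  have -> : E l f = g + E n (E l f) by rewrite subrK.
  apply: le_trans (L2normD _ _) _; rewrite g0 add0r.
  by rewrite subrK.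
apply/eqP; rewrite eq_le L2norm_ge0 andbT.
apply/ler_addgt0Pl => e e0; rewrite addr0.
have : \forall y \near -oo, L2norm (E y (E l f)) < e /\ y <= l.
  near=> y; split; last by near: y; exact: nbhs_ninfty_le (num_real l).
  rewrite -[X in X < _]ger0_norm ?L2norm_ge0// -normrN -sub0r.
  near: y; exact: (@cvgr_dist_lt _ _ _ _ _ _ _ (resol_ninfty hE _)).
case/filter_ex => a [fa al].
exact: (le_trans (key _ al) (ltW fa)).
Unshelve. all: by end_near. Qed.

(** As E_(-1) = 0, the spectral measure of f is carried by ]-1, l]. *)
Lemma resol_ran_domL l f : E l f = f %[ae mu] -> domL D f.
Proof. by apply: (@resol_block_domL _ _ _ _ _ _ hE (-1)); exact: resol_lt0. Qed.

(** Cauchy-Schwarz for the form: since k = A f and f are both in the range of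
    E_l, |k|^4 = fval f k ^2 <= fval f f * fval k k <= l |f|^2 * l |k|^2. *)
Lemma laplacian_norm_le l f k : 0 <= l -> E l f = f %[ae mu] ->
  E l k = k %[ae mu] -> laplacian D f k -> L2norm k <= l * L2norm f.
Proof.
move=> l0 lf lk fk.
have kD := domL_fdom (resol_ran_domL lk).
have [k' kk'] := resol_ran_domL lk.
have h1 := resol_le_sup hE fk lf.
have h2 := resol_le_sup hE kk' lk.
have := fval_CauchySchwarz hD (proj1 fk) kD.
rewrite (proj2 fk _ kD) (proj2 fk _ (proj1 fk)) (proj2 kk' _ kD).
have := fval_ge0 hD (proj1 fk); rewrite (proj2 fk _ (proj1 fk)).
have := fval_ge0 hD kD; rewrite (proj2 kk' _ kD).
move: h1 h2; rewrite -!L2norm_sqr.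
have := L2norm_ge0 f; have := L2norm_ge0 k.
move: (L2norm f) (L2norm k) (L2dot _ _) (L2dot _ _).
move=> a b x y b0 a0 xl yl y0 x0 h.
have [->|bn] := eqVneq b 0; first by rewrite mulr_ge0.
have bp : 0 < b by rewrite lt_neqAle eq_sym bn.
have h' : (b ^+ 2) ^+ 2 <= (l * a ^+ 2) * (l * b ^+ 2).
  by apply: le_trans h _; apply: ler_pM.
have : b ^+ 2 <= (l * a) ^+ 2.
  rewrite -(@ler_pM2r _ (b ^+ 2)) ?exprn_gt0//.
  by apply: le_trans h' _; rewrite le_eqVlt; apply/orP; left; apply/eqP; ring.
by rewrite ler_pXn2r// nnegrE ?mulr_ge0// ltW.
Qed.

(** l |f|^2 <= <A f, f> <= |A f| |f|. *)
Lemma laplacian_norm_ge l f k : E l f = (0 : L2 mu) %[ae mu] ->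
  laplacian D f k -> l * L2norm f <= L2norm k.
Proof.
move=> lf fk.
have := resol_ge_inf hE fk lf; rewrite -L2norm_sqr => h.
have h2 := le_trans h (le_trans (ler_norm _) (L2dot_CauchySchwarz _ _)).
have [f0|f0] := eqVneq (L2norm f) 0; first by rewrite f0 mulr0 L2norm_ge0.
have fp : 0 < L2norm f by rewrite lt_neqAle eq_sym f0 L2norm_ge0.
by rewrite -(ler_pM2r fp) -mulrA -expr2.
Qed.

(** In this section P v is the orthogonal projection of v onto Y for the inner
    product and the form simultaneously.  It lives on the form domain, which
    contains the ranges of all the E_l. *)
Section reducing.
Variables (Y : set (L2 mu)) (P : L2 mu -> L2 mu).
Hypothesis YD : Y `<=` fdom D.
Hypothesis PY : forall v, fdom D v -> Y (P v).
Hypothesis Pdot : forall u v, Y u -> fdom D v -> L2dot u v = L2dot u (P v).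
Hypothesis Pval : forall u v, Y u -> fdom D v -> fval D u v = fval D u (P v).

Lemma proj_norm v : fdom D v -> L2norm (P v) <= L2norm v.
Proof.
move=> Dv.
have [->|n0] := eqVneq (L2norm (P v)) 0; first exact: L2norm_ge0.
have npos : 0 < L2norm (P v) by rewrite lt_neqAle eq_sym n0 L2norm_ge0.
rewrite -(ler_pM2l npos) -expr2 L2norm_sqr -Pdot//; last exact: PY.
exact: le_trans (ler_norm _) (L2dot_CauchySchwarz _ _).
Qed.

Lemma proj_dot_sym u v : fdom D u -> fdom D v -> L2dot (P u) v = L2dot u (P v).
Proof.
move=> Du Dv; have [Yu Yv] := (PY Du, PY Dv).
by rewrite Pdot// L2dotC -Pdot// L2dotC.
Qed.

Lemma proj_val_sym u v : fdom D u -> fdom D v ->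
  fval D (P u) v = fval D u (P v).
Proof.
move=> Du Dv; have [Yu Yv] := (PY Du, PY Dv).
rewrite Pval// (fval_sym hD (YD Yu) (YD Yv)) -Pval// (fval_sym hD) //.
exact: YD.
Qed.

(** P is symmetric for both the form and the inner product. *)
Lemma laplacian_proj f k : laplacian D f k -> fdom D k ->
  laplacian D (P f) (P k).
Proof.
move=> fk Dk; have Df := proj1 fk; split; first by apply: YD; exact: PY.
move=> v Dv; rewrite proj_val_sym// proj_dot_sym//.
by apply: (proj2 fk); apply: YD; exact: PY.
Qed.

(** Let h = P f - E_b (P f).  Then A h is the vector attached in the same way
    to A f, which is again in the range of E_l.  Replacing f by A f multiplies
    |f| by at most l, and |h| by at least b. *)
Lemma proj_iter (l b : R) n f : 0 <= l -> 0 <= b -> E l f = f %[ae mu] ->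
  b ^+ n * L2norm (P f - E b (P f)) <= l ^+ n * L2norm f.
Proof.
move=> l0 b0; elim: n f => [|n IH] f lf.
  rewrite !expr0 !mul1r.
  have Df := domL_fdom (resol_ran_domL lf).
  apply: le_trans (proj_norm Df).
  rewrite -(@ler_pXn2r _ 2)// ?nnegrE ?L2norm_ge0// !L2norm_sqr.
  rewrite L2dotBl L2dotBr L2dotBr (dot_resol hE).
  rewrite (L2dotC (P f) (E b _)) subrr subr0 gerBl.
  by rewrite -(dot_resol hE) L2dot_ge0.
have [g fg] := resol_ran_domL lf.
have lg' : E l (E l g) = E l g %[ae mu] by exact: (resol_idem hE).
have fg' : laplacian D f (E l g).
  exact: laplacian_ae lf (aeq_refl _) (laplacian_resol l fg).
have Dg' := domL_fdom (resol_ran_domL lg').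
have hg := laplacian_proj fg' Dg'.
have hk := laplacianB hD hg (laplacian_resol b hg).
have := laplacian_norm_ge (resol_ker_compl hE b _) hk.
have := laplacian_norm_le l0 lf lg' fg'.
have := IH _ lg'.
have kn : 0 <= b ^+ n by rewrite exprn_ge0.
have ln : 0 <= l ^+ n by rewrite exprn_ge0.
rewrite !exprSr -!mulrA => h1 h2 h3.
apply: le_trans (ler_wpM2l kn h3) _; apply: le_trans h1 _.
exact: ler_wpM2l.
Qed.

(** (l / b)^n tends to 0 in [proj_iter].  For l < 0 the range of E_l is 0. *)
Lemma proj_resol_above (l b : R) f : l < b -> E l f = f %[ae mu] ->
  E b (P f) = P f %[ae mu].
Proof.
move=> lb lf.
have [l0|l0] := ltP l 0.
  have f0 : L2norm f = 0.
    rewrite -(L2norm_ae lf) -[E l f]subr0; apply: L2norm_sub_ae.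
    exact: resol_lt0.
  have Df := domL_fdom (resol_ran_domL lf).
  have P0 : P f = (0 : L2 mu) %[ae mu].
    apply: L2norm_eq0; rewrite subr0; apply/eqP; rewrite eq_le L2norm_ge0 andbT.
    by rewrite -f0; exact: proj_norm.
  apply: (aeq_trans (resol_ae hE b P0)); apply: (aeq_trans (resol0 hE b)).
  exact: aeq_sym.
have b0 : 0 < b by apply: le_lt_trans lb.
apply: aeq_sym; apply: L2norm_eq0; apply/eqP; rewrite eq_le L2norm_ge0 andbT.
have cv : (l / b) ^+ n * L2norm f @[n --> \oo] --> (0 : R).
  rewrite -(mul0r (L2norm f)); apply: cvgMl; apply: cvg_expr.
  by rewrite ger0_norm ?divr_ge0// ?ltW// ltr_pdivrMr// mul1r.
rewrite -(cvg_lim (@Rhausdorff R) cv).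
apply: limr_ge; first by apply/cvg_ex; exists 0.
apply: nearW => n /=.
rewrite expr_div_n mulrAC ler_pdivlMr ?exprn_gt0// mulrC.
by apply: proj_iter => //; exact: ltW.
Qed.

(** Let b decrease to l in [proj_resol_above]. *)
Lemma proj_resol_ran l f : E l f = f %[ae mu] -> E l (P f) = P f %[ae mu].
Proof.
move=> lf; apply: aeq_sym; apply: L2norm_eq0; apply/eqP.
rewrite eq_le L2norm_ge0 andbT; apply/ler_addgt0Pl => e e0; rewrite addr0.
have : \forall y \near l^'+, L2norm (E y (P f) - E l (P f)) < e /\ l < y.
  near=> y; split; last by near: y; exact: nbhs_right_gt.
  rewrite -[X in X < _]ger0_norm ?L2norm_ge0// -normrN -sub0r.
  near: y; exact: (@cvgr_dist_lt _ _ _ _ _ _ _ (resol_right_continuous hE _ _)).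
case/(@filter_ex _ _ (at_right_proper_filter l)) => y [ye ly].
rewrite (L2norm_ae (aeB (aeq_sym (proj_resol_above ly lf)) (aeq_refl _))).
exact: ltW.
Unshelve. all: by end_near. Qed.

(** [proj_resol_ran] says E_l P E_l = P E_l.  Taking adjoints,
    E_l P = E_l P E_l = P E_l, and P is the identity on Y. *)
Lemma reducing_resol l y : Y y -> E l y = P (E l y) %[ae mu].
Proof.
move=> Yy; apply: L2dot_eq0 => f.
have ry := resol_idem hE l y; have rf := resol_idem hE l f.
have Df := domL_fdom (resol_ran_domL rf).
have Dy := domL_fdom (resol_ran_domL ry).
rewrite (resol_sym hE) Pdot// -(L2dot_aer _ (proj_resol_ran rf)).
rewrite -(resol_sym hE) -proj_dot_sym// -(resol_sym hE).
exact: L2dot_ae (proj_resol_ran ry).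
Qed.

Lemma reducing_resol_laplacian l y : Y y ->
  exists p q, [/\ Y p, Y q, E l y = p %[ae mu] & laplacian D p q].
Proof.
move=> Yy; have ry := resol_idem hE l y.
have [k yk] := resol_ran_domL ry.
have rk := resol_idem hE l k.
have Dk := domL_fdom (resol_ran_domL rk).
exists (P (E l y)), (P (E l k)); split.
- by apply: PY; exact: proj1 yk.
- exact: PY.
- exact: reducing_resol.
- apply: laplacian_proj => //.
  exact: laplacian_ae ry (aeq_refl _) (laplacian_resol l yk).
Qed.

End reducing.
End Commutation.

(** * Change of variables *)

(** Only F and F o p are asked to be measurable, so that the lemmas apply to
    the gluing map pi without comparing the product sigma-algebra with the
    Borel sets of the product. *)
Section Transfer.
Context d1 d2 (X : measurableType d1) (Y : measurableType d2) (R : realType).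
Variables (m : {measure set X -> \bar R}) (mu : {measure set Y -> \bar R}).
Variables (p : X -> Y) (F : Y -> R).
Hypothesis mF : measurable_fun setT F.
Hypothesis mFp : measurable_fun setT (F \o p).
Hypothesis pF : forall B : set R, measurable B ->
  m (p @^-1` (F @^-1` B)) = mu (F @^-1` B).

Lemma transfer_ge0_integral (G : R -> \bar R) : measurable_fun setT G ->
  (forall x, 0 <= G x)%E ->
  (\int[mu]_y G (F y) = \int[m]_x G (F (p x)))%E.
Proof.
move=> mG G0.
transitivity (\int[pushforward mu F]_z G z)%E.
  by rewrite [RHS]ge0_integral_pushforward.
transitivity (\int[pushforward m (F \o p)]_z G z)%E; last first.
  by rewrite [LHS]ge0_integral_pushforward.
apply: eq_measure_integral => A mA _ /=.
by rewrite /pushforward pF.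
Qed.

Lemma transfer_Rintegral : \int[mu]_y F y = \int[m]_x F (p x).
Proof.
rewrite /Rintegral; congr fine.
rewrite integralE [RHS]integralE.
have EFp : measurable_fun setT (@EFin R) by exact/measurable_EFinP.
congr (_ - _)%E.
- rewrite -[fun y => (F y)%:E]/(EFin \o F).
  rewrite -[fun x => (F (p x))%:E]/(EFin \o (F \o p)).
  rewrite (funepos_comp _ F) (funepos_comp _ (F \o p)).
  exact: (transfer_ge0_integral (measurable_funepos EFp) (funepos_ge0 _)).
- rewrite -[fun y => (F y)%:E]/(EFin \o F).
  rewrite -[fun x => (F (p x))%:E]/(EFin \o (F \o p)).
  rewrite (funeneg_comp _ F) (funeneg_comp _ (F \o p)).
  exact: (transfer_ge0_integral (measurable_funeneg EFp) (funeneg_ge0 _)).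
Qed.

Lemma transfer_integrable : mu.-integrable setT (EFin \o F) ->
  m.-integrable setT (EFin \o (F \o p)).
Proof.
move=> /integrableP[_ iF].
apply/integrableP; split; first exact/measurable_EFinP.
rewrite -(@transfer_ge0_integral (fun x => `|x%:E|%E))//.
by apply: measurableT_comp => //; exact/measurable_EFinP.
Qed.

End Transfer.

Section PullBack.
Context d1 d2 (X : measurableType d1) (Y : measurableType d2) (R : realType).
Variables (m : {measure set X -> \bar R}) (mu : {measure set Y -> \bar R}).
Variable p : X -> Y.
Hypothesis mp : measurable_fun setT p.
Hypothesis pmu : forall A, measurable A -> m (p @^-1` A) = mu A.

Lemma L2_comp_Lfun (u : L2 mu) : (u : Y -> R) \o p \in Lfun m 2%:E.
Proof.
have mu_ : measurable_fun setT u by [].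
have mup : measurable_fun setT ((u : Y -> R) \o p) by exact: measurableT_comp.
apply/andP; split; first by rewrite inE.
rewrite inE/= /finite_norm.
have : ('N[mu]_2[EFin \o u] < +oo)%E by exact: Lfunction_finite.
rewrite unlock /=.
rewrite (@transfer_ge0_integral _ _ _ _ _ m mu p u _ mup _
  (fun x => (`|x| `^ 2)%:E))//.
- move=> B mB; apply: pmu; rewrite -[_ @^-1` _]setTI; exact: mu_.
- apply/measurable_EFinP.
  exact: (@measurableT_comp _ _ _ _ _ _ (@powR R ^~ 2)).
Qed.

Definition L2_comp (u : L2 mu) : L2 m := Lfun_Sub (lee1n 2) (L2_comp_Lfun u).

Lemma L2_comp_linear a u v : L2_comp (a *: u + v) = a *: L2_comp u + L2_comp v.
Proof. exact/val_inj. Qed.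

Lemma L2_comp_dot u v : L2dot (L2_comp u) (L2_comp v) = L2dot u v.
Proof.
have mu_ : measurable_fun setT (fun y => u y * v y) by exact: measurable_funM.
rewrite /L2dot [RHS](@transfer_Rintegral _ _ _ _ _ m mu p)//.
- exact: (measurableT_comp mu_ mp).
- by move=> B mB; apply: pmu; rewrite -[_ @^-1` _]setTI; exact: mu_.
Qed.

End PullBack.

(** * Isometric extension between closed forms *)

Section FormNorm.
Context d (T : measurableType d) (R : realType).
Variable mu : {measure set T -> \bar R}.
Variable D : L2form mu.
Hypothesis hD : nonneg_symmetric_form D.
Implicit Types u v w f : L2 mu.

Lemma fnorm_ge0 u : 0 <= fnorm D u.
Proof. by rewrite addr_ge0 ?sqrtr_ge0 ?L2norm_ge0. Qed.

Lemma fnormD u v : fdom D u -> fdom D v ->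
  fnorm D (u + v) <= fnorm D u + fnorm D v.
Proof.
by move=> Du Dv; rewrite /fnorm addrACA lerD ?L2normD ?(sqrt_fvalD hD).
Qed.

Lemma fnorm_distC u v : fdom D u -> fdom D v ->
  fnorm D (u - v) = fnorm D (v - u).
Proof.
move=> Du Dv; rewrite /fnorm L2norm_distC -(sqrt_fvalN hD) ?opprB//.
exact: fdomB.
Qed.

Lemma L2norm_fnorm u : L2norm u <= fnorm D u.
Proof. by rewrite lerDr sqrtr_ge0. Qed.

Lemma sqrt_fval_fnorm u : Num.sqrt (fval D u u) <= fnorm D u.
Proof. by rewrite lerDl L2norm_ge0. Qed.

Lemma fval_le_fnorm u v : fdom D u -> fdom D v ->
  `|fval D u v| <= Num.sqrt (fval D u u) * fnorm D v.
Proof.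
move=> Du Dv; apply: le_trans (fval_CauchySchwarz_sqrt hD Du Dv) _.
by rewrite ler_wpM2l ?sqrtr_ge0// sqrt_fval_fnorm.
Qed.

Lemma L2dot_le_fnorm f v : `|L2dot f v| <= L2norm f * fnorm D v.
Proof.
apply: le_trans (L2dot_CauchySchwarz f v) _.
by rewrite ler_wpM2l ?L2norm_ge0// L2norm_fnorm.
Qed.

End FormNorm.

Lemma small_eq0 (R : realType) (x c : R) : 0 <= c ->
  (forall e, 0 < e -> `|x| <= c * e) -> x = 0.
Proof.
move=> c0 h; apply/eqP; rewrite -normr_le0; apply/ler_addgt0Pl => e e0.
rewrite addr0; have c1 : 0 < c + 1 by rewrite ltr_wpDl.
apply: le_trans (h (e / (c + 1)) _) _; first by rewrite divr_gt0.
rewrite mulrA ler_pdivrMr// [leRHS]mulrC; nra.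
Qed.

Section Approximation.
Context d (T : measurableType d) (R : realType).
Variable mu : {measure set T -> \bar R}.
Variable D : L2form mu.
Hypothesis hD : nonneg_symmetric_form D.

Lemma approx_seq (C : set (L2 mu)) v :
  (forall e : R, 0 < e -> exists2 w, C w & fnorm D (v - w) < e) ->
  exists w : nat -> L2 mu, (forall n, C (w n)) /\
    forall e, 0 < e -> exists N, forall n, (N <= n)%N -> fnorm D (v - w n) < e.
Proof.
move=> h.
have h' (n : nat) : exists w, C w /\ fnorm D (v - w) < n.+1%:R^-1.
  have n0 : 0 < (n.+1%:R^-1 : R) by rewrite invr_gt0.
  by have [w Cw lw] := h _ n0; exists w.
have [w hw] := choice h'; exists w; split; first by move=> n; have [] := hw n.
move=> e e0.
exists (Num.bound e^-1) => n Nn.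
apply: lt_le_trans (proj2 (hw n)) _.
rewrite -[leRHS]invrK lef_pV2 ?posrE ?invr_gt0//.
have := archi_boundP (ltW (_ : 0 < e^-1)); rewrite invr_gt0 => /(_ e0) /ltW.
move=> /le_trans; apply; rewrite ler_nat; exact: leq_trans Nn _.
Qed.

End Approximation.

Section Isometry.
Context d1 d2 (T1 : measurableType d1) (T2 : measurableType d2) (R : realType).
Variables (mu1 : {measure set T1 -> \bar R}) (mu2 : {measure set T2 -> \bar R}).
Variables (D1 : L2form mu1) (D2 : L2form mu2).
Hypothesis hD1 : nonneg_symmetric_form D1.
Hypothesis hD2 : closed_form D2.
Let sD2 := proj1 hD2.
Variable J : L2 mu1 -> L2 mu2.
Hypothesis J_linear : forall a u v, J (a *: u + v) = a *: J u + J v.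
Hypothesis J_dot : forall u v, L2dot (J u) (J v) = L2dot u v.

Lemma isom_B u v : J (u - v) = J u - J v.
Proof.
by have := J_linear (-1) v u; rewrite !scaleN1r addrC (addrC (- J v)).
Qed.

Lemma isom_D u v : J (u + v) = J u + J v.
Proof. by have := J_linear 1 u v; rewrite !scale1r. Qed.

Lemma isom_norm u : L2norm (J u) = L2norm u.
Proof. by rewrite !L2norm_sqrt J_dot. Qed.

Variable C : set (L2 mu1).
Hypothesis CD : C `<=` fdom D1.
Hypothesis CB : forall u v, C u -> C v -> C (u - v).
Hypothesis C_dense : forall u (e : R), fdom D1 u -> 0 < e ->
  exists2 v, C v & fnorm D1 (u - v) < e.
Hypothesis JC : forall u, C u ->
  fdom D2 (J u) /\ fval D2 (J u) (J u) = fval D1 u u.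

Let isom_fnorm u : C u -> fnorm D2 (J u) = fnorm D1 u.
Proof. by move=> Cu; rewrite /fnorm isom_norm (proj2 (JC Cu)). Qed.

(** The images of approximations of u in C form a Cauchy sequence for D2.  Its
    limit equals J u almost everywhere, and the energies converge. *)
Let isom_ext u : fdom D1 u ->
  fdom D2 (J u) /\ fval D2 (J u) (J u) = fval D1 u u.
Proof.
move=> Du.
have [w [Cw wu]] := approx_seq (fun e => C_dense Du (e := e)).
have Dw n : fdom D1 (w n) := CD (Cw n).
have DJw n : fdom D2 (J (w n)) := proj1 (JC (Cw n)).
have cau (e : R) : 0 < e -> exists N, forall m n, (N <= m)%N -> (N <= n)%N ->
    fnorm D2 (J (w m) - J (w n)) < e.
  move=> e0; have e2 : 0 < e / 2 by rewrite divr_gt0.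
  have [N hN] := wu _ e2; exists N => m n Nm Nn.
  rewrite -isom_B isom_fnorm; last exact: CB.
  have -> : w m - w n = (w m - u) + (u - w n) by rewrite addrA subrK.
  apply: le_lt_trans (fnormD hD1 _ _) _; [exact: fdomB|exact: fdomB|].
  by rewrite (splitr e) ltrD// ?hN// fnorm_distC// hN.
have [v Dv cv] := proj2 hD2 _ DJw cau.
have Juv : J u = v %[ae mu2].
  apply: L2norm_eq0; apply: (@small_eq0 _ _ 2) => // e e0.
  have [N hN] := wu _ e0.
  move/cvgrPdist_lt : cv => /(_ _ e0) [M _ hM].
  have {}hN := hN _ (leq_maxl N M); have {}hM := hM _ (leq_maxr N M).
  rewrite ger0_norm ?L2norm_ge0//.
  set n := maxn N M in hN hM *.
  have -> : J u - v = J (u - w n) + (J (w n) - v) by rewrite isom_B addrA subrK.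
  apply: le_trans (L2normD _ _) _; rewrite isom_norm mulrDl mul1r lerD//.
    exact: le_trans (L2norm_fnorm D1 _) (ltW hN).
  apply: le_trans (L2norm_fnorm D2 _) _.
  by move: hM; rewrite /= sub0r normrN ger0_norm ?fnorm_ge0// => /ltW.
have DJu : fdom D2 (J u) by apply: fdom_ae (aeq_sym Juv).
split=> //.
rewrite (fval_ae2 sD2 DJu DJu Juv Juv).
suff : Num.sqrt (fval D2 v v) = Num.sqrt (fval D1 u u).
  move=> /(congr1 (fun x => x ^+ 2)); rewrite !sqr_sqrtr//.
    exact: fval_ge0.
  exact: fval_ge0.
apply/eqP; rewrite -subr_eq0; apply/eqP.
apply: (@small_eq0 _ _ 2) => // e e0.
have [N hN] := wu _ e0.
move/cvgrPdist_lt : cv => /(_ _ e0) [M _ hM].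
have {}hN := hN _ (leq_maxl N M); have {}hM := hM _ (leq_maxr N M).
set n := maxn N M in hN hM *.
have {}hM : fnorm D2 (J (w n) - v) < e.
  by move: hM; rewrite /= sub0r normrN ger0_norm ?fnorm_ge0.
have a1 : Num.sqrt (fval D2 v v) <= Num.sqrt (fval D1 (w n) (w n)) + e.
  have -> : v = J (w n) - (J (w n) - v) by rewrite subKr.
  apply: le_trans (sqrt_fvalB sD2 _ _) _ => //; first exact: fdomB.
  rewrite (proj2 (JC (Cw n))) lerD2l.
  exact: le_trans (sqrt_fval_fnorm D2 _) (ltW hM).
have a2 : Num.sqrt (fval D1 (w n) (w n)) <= Num.sqrt (fval D2 v v) + e.
  rewrite -(proj2 (JC (Cw n))).
  have {1 2}-> : J (w n) = v + (J (w n) - v) by rewrite addrC subrK.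
  apply: le_trans (sqrt_fvalD sD2 _ _) _ => //; first exact: fdomB.
  by rewrite lerD2l; exact: le_trans (sqrt_fval_fnorm D2 _) (ltW hM).
have a3 : Num.sqrt (fval D1 (w n) (w n)) <= Num.sqrt (fval D1 u u) + e.
  have {1 2}-> : w n = u - (u - w n) by rewrite subKr.
  apply: le_trans (sqrt_fvalB hD1 _ _) _ => //; first exact: fdomB.
  by rewrite lerD2l; exact: le_trans (sqrt_fval_fnorm D1 _) (ltW hN).
have a4 : Num.sqrt (fval D1 u u) <= Num.sqrt (fval D1 (w n) (w n)) + e.
  have {1 2}-> : u = w n + (u - w n) by rewrite addrC subrK.
  apply: le_trans (sqrt_fvalD hD1 _ _) _ => //; first exact: fdomB.
  by rewrite lerD2l; exact: le_trans (sqrt_fval_fnorm D1 _) (ltW hN).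
move: a1 a2 a3 a4; rewrite ler_norml.
move: (Num.sqrt _) (Num.sqrt _) (Num.sqrt _) => x y z *; apply/andP; split; lra.
Qed.

Lemma isom_fdom u : fdom D1 u -> fdom D2 (J u).
Proof. by move=> /isom_ext[]. Qed.

Lemma isom_fval u v : fdom D1 u -> fdom D1 v ->
  fval D2 (J u) (J v) = fval D1 u v.
Proof.
move=> Du Dv.
have [DJu Eu] := isom_ext Du; have [DJv Ev] := isom_ext Dv.
have [_] := isom_ext (fdomD hD1 Du Dv).
rewrite isom_D (fvalDl sD2) ?(fvalDr sD2)//; last exact: fdomD.
rewrite (fvalDl hD1) ?(fvalDr hD1)//; last exact: fdomD.
rewrite Eu Ev (fval_sym sD2 DJv DJu) (fval_sym hD1 Dv Du).
move: (fval D1 u u) (fval D1 v v) (fval _ _ _) (fval _ _ _) => a b x y; lra.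
Qed.

End Isometry.

(** * Projections that are orthogonal for the inner product and the form *)

Section Chain.
Context d (T : measurableType d) (R : realType).
Variable mu : {measure set T -> \bar R}.
Variable D : L2form mu.
Variables X H : nat -> set (L2 mu).
Hypothesis Xmono : forall k, X k `<=` X k.+1.
Hypothesis Hmono : forall k, H k `<=` H k.+1.
Hypothesis Xstep : forall k v, X k.+1 v -> exists s, [/\ X k s,
  forall u, X k u -> fval D u v = fval D u s &
  forall f, H k f -> L2dot f v = L2dot f s].

Lemma chain_mono (Z : nat -> set (L2 mu)) : (forall k, Z k `<=` Z k.+1) ->
  forall i k, (i <= k)%N -> Z i `<=` Z k.
Proof.
move=> mono i; elim=> [|k IH]; first by rewrite leqn0 => /eqP ->.
rewrite leq_eqVlt => /predU1P[->//|]; rewrite ltnS => /IH h.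
exact: subset_trans h (@mono k).
Qed.

(** Project one step at a time: a step from X k to X (k - 1) is compatible with
    testing against the smaller spaces X i and H i. *)
Lemma chain_proj i k v : X k v -> exists s, [/\ X i s,
  forall u, X i u -> fval D u v = fval D u s &
  forall f, H i f -> L2dot f v = L2dot f s].
Proof.
elim: k v => [|k IH] v Xv.
  by exists v; split=> //; exact: (chain_mono Xmono (leq0n i)).
have [ik|ki] := leqP i k; last first.
  by exists v; split=> //; exact: (chain_mono Xmono ki).
have [s [Xs s1 s2]] := Xstep Xv; have [t [Xt t1 t2]] := IH _ Xs.
exists t; split=> //.
- by move=> u Xu; rewrite s1 ?t1//; exact: (chain_mono Xmono ik).
- by move=> f Hf; rewrite s2 ?t2//; exact: (chain_mono Hmono ik).
Qed.

End Chain.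

Section Projection.
Context d1 d2 (T1 : measurableType d1) (T2 : measurableType d2) (R : realType).
Variables (mu1 : {measure set T1 -> \bar R}) (mu2 : {measure set T2 -> \bar R}).
Variables (D1 : L2form mu1) (D2 : L2form mu2).
Hypothesis hD1 : closed_form D1.
Hypothesis hD2 : nonneg_symmetric_form D2.
Let sD1 := proj1 hD1.
Variable J : L2 mu1 -> L2 mu2.
Hypothesis J_linear : forall a u v, J (a *: u + v) = a *: J u + J v.
Hypothesis J_dot : forall u v, L2dot (J u) (J v) = L2dot u v.
Hypothesis J_fdom : forall u, fdom D1 u -> fdom D2 (J u).
Hypothesis J_fval : forall u v, fdom D1 u -> fdom D1 v ->
  fval D2 (J u) (J v) = fval D1 u v.
Variable C : set (L2 mu1).
Hypothesis CD : C `<=` fdom D1.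
Hypothesis CB : forall u v, C u -> C v -> C (u - v).
Hypothesis C_dense : forall u (e : R), fdom D1 u -> 0 < e ->
  exists2 v, C v & fnorm D1 (u - v) < e.
Variable X : set (L2 mu2).
Hypothesis XD : X `<=` fdom D2.
Hypothesis X_dense : forall u (e : R), fdom D2 u -> 0 < e ->
  exists2 v, X v & fnorm D2 (u - v) < e.
Hypothesis X_proj : forall v, X v -> exists s, [/\ C s,
  forall u, C u -> fval D2 (J u) v = fval D2 (J u) (J s) &
  forall f, L2dot (J f) v = L2dot (J f) (J s)].

Let J_fnorm u : fdom D1 u -> fnorm D2 (J u) = fnorm D1 u.
Proof. by move=> Du; rewrite /fnorm (isom_norm J_dot) J_fval. Qed.

(** E(J s, J s) = E(J s, v) and <J s, J s> = <J s, v>, so Cauchy-Schwarz bounds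
    both parts of the norm. *)
Let contraction s v : C s -> fdom D2 v ->
  (forall u, C u -> fval D2 (J u) v = fval D2 (J u) (J s)) ->
  (forall f, L2dot (J f) v = L2dot (J f) (J s)) -> fnorm D1 s <= fnorm D2 v.
Proof.
move=> Cs Dv sval sdot; rewrite -J_fnorm; last exact: CD.
have DJs := J_fdom (CD Cs).
apply: lerD.
  have h := fval_CauchySchwarz_sqrt hD2 DJs Dv.
  move: h; rewrite (sval _ Cs) => /(le_trans (ler_norm _)).
  rewrite -{1}(sqr_sqrtr (fval_ge0 hD2 DJs)) expr2.
  have [-> _|n0] := eqVneq (Num.sqrt (fval D2 (J s) (J s))) 0.
    exact: sqrtr_ge0.
  by rewrite ler_pM2l// lt_neqAle eq_sym n0 sqrtr_ge0.
have [->|n0] := eqVneq (L2norm (J s)) 0; first exact: L2norm_ge0.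
have npos : 0 < L2norm (J s) by rewrite lt_neqAle eq_sym n0 L2norm_ge0.
rewrite -(ler_pM2l npos) -expr2 L2norm_sqr -sdot.
exact: le_trans (ler_norm _) (L2dot_CauchySchwarz _ _).
Qed.

(** Approximate v by w n in X and project to s n in C.  By contraction the s n
    are a Cauchy sequence for D1; completeness of D1 gives t.  The two
    identities pass to the limit, the first one for u in C, hence by density
    for u in the domain of D1. *)
Lemma form_projection v : fdom D2 v -> exists t, [/\ fdom D1 t,
  forall u, fdom D1 u -> fval D2 (J u) v = fval D2 (J u) (J t) &
  forall f, L2dot (J f) v = L2dot (J f) (J t)].
Proof.
move=> Dv.
have [w [Xw wv]] := approx_seq (fun e => X_dense Dv (e := e)).
have Dw n : fdom D2 (w n) := XD (Xw n).
have [s sP] := choice (fun n => X_proj (Xw n)).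
have Cs n : C (s n) by have [] := sP n.
have Ds n : fdom D1 (s n) := CD (Cs n).
have sval n u : C u -> fval D2 (J u) (w n) = fval D2 (J u) (J (s n)).
  by have [_ h _] := sP n; exact: h.
have sdot n f : L2dot (J f) (w n) = L2dot (J f) (J (s n)).
  by have [_ _ h] := sP n; exact: h.
have JB := isom_B J_linear.
have cau (e : R) : 0 < e -> exists N, forall m n, (N <= m)%N -> (N <= n)%N ->
    fnorm D1 (s m - s n) < e.
  move=> e0; have e2 : 0 < e / 2 by rewrite divr_gt0.
  have [N hN] := wv _ e2; exists N => m n Nm Nn.
  have DJm := J_fdom (Ds m); have DJn := J_fdom (Ds n).
  apply: (@le_lt_trans _ _ (fnorm D2 (w m - w n))).
    apply: contraction; [exact: CB|exact: fdomB| |].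
    - move=> u Cu; have DJu := J_fdom (CD Cu).
      by rewrite JB (fvalBr hD2) ?(fvalBr hD2)// !sval.
    - by move=> f; rewrite JB !L2dotBr !sdot.
  have -> : w m - w n = (w m - v) + (v - w n) by rewrite addrA subrK.
  apply: le_lt_trans (fnormD hD2 _ _) _; [exact: fdomB|exact: fdomB|].
  by rewrite (splitr e) ltrD// ?hN// (fnorm_distC hD2)// hN.
have [t Dt ct] := proj2 hD1 _ Ds cau.
have DJt := J_fdom Dt.
exists t.
have both (e : R) : 0 < e -> exists n, fnorm D2 (v - w n) <= e /\
    fnorm D2 (J (s n) - J t) <= e.
  move=> e0; have [N hN] := wv _ e0.
  move/cvgrPdist_lt : ct => /(_ _ e0) [M _ hM].
  have {}hN := hN _ (leq_maxl N M); have {}hM := hM _ (leq_maxr N M).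
  exists (maxn N M); split; first exact: ltW.
  rewrite -JB J_fnorm; last exact: fdomB.
  by move: hM; rewrite /= sub0r normrN ger0_norm ?fnorm_ge0// => /ltW.
have tval u : C u -> fval D2 (J u) v = fval D2 (J u) (J t).
  move=> Cu; have DJu := J_fdom (CD Cu).
  apply/eqP; rewrite -subr_eq0; apply/eqP.
  apply: (@small_eq0 _ _ (2 * Num.sqrt (fval D2 (J u) (J u)))).
    by rewrite mulr_ge0// sqrtr_ge0.
  move=> e e0; have [n [n1 n2]] := both _ e0.
  have DJn := J_fdom (Ds n).
  have -> : fval D2 (J u) v - fval D2 (J u) (J t) =
      fval D2 (J u) (v - w n) + fval D2 (J u) (J (s n) - J t).
    by rewrite !(fvalBr hD2)// sval//; ring.
  apply: le_trans (ler_normD _ _) _.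
  have h1 := fval_le_fnorm hD2 DJu (fdomB hD2 Dv (Dw n)).
  have h2 := fval_le_fnorm hD2 DJu (fdomB hD2 DJn DJt).
  have := sqrtr_ge0 (fval D2 (J u) (J u)).
  move: h1 h2 n1 n2; set q := Num.sqrt _.
  move: (`|_|) (`|_|) (fnorm _ _) (fnorm _ _) => *.
  nra.
split=> //.
- move=> u Du; have DJu := J_fdom Du.
  apply/eqP; rewrite -subr_eq0 -(fvalBr hD2)//; apply/eqP.
  have Dvt := fdomB hD2 Dv DJt.
  apply: (@small_eq0 _ _ (fnorm D2 (v - J t))); first exact: fnorm_ge0.
  move=> e e0; have [c Cc uc] := C_dense Du e0.
  have DJc := J_fdom (CD Cc).
  have vtc : fval D2 (v - J t) (J c) = 0.
    by rewrite (fval_sym hD2 Dvt DJc) (fvalBr hD2)// tval// subrr.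
  have -> : fval D2 (J u) (v - J t) = fval D2 (v - J t) (J (u - c)).
    by rewrite JB [RHS](fvalBr hD2)// vtc subr0 (fval_sym hD2 DJu Dvt).
  apply: le_trans (fval_le_fnorm hD2 Dvt _) _.
    by rewrite JB; exact: (fdomB hD2).
  rewrite J_fnorm; last by apply: (fdomB sD1) => //; exact: CD.
  apply: ler_pM; rewrite ?sqrtr_ge0 ?fnorm_ge0 ?sqrt_fval_fnorm//.
  exact: ltW.
- move=> f; apply/eqP; rewrite -subr_eq0; apply/eqP.
  apply: (@small_eq0 _ _ (2 * L2norm (J f))).
    by rewrite mulr_ge0// L2norm_ge0.
  move=> e e0; have [n [n1 n2]] := both _ e0.
  have -> : L2dot (J f) v - L2dot (J f) (J t) =
      L2dot (J f) (v - w n) + L2dot (J f) (J (s n) - J t).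
    by rewrite !L2dotBr sdot; ring.
  apply: le_trans (ler_normD _ _) _.
  have h1 := L2dot_le_fnorm D2 (J f) (v - w n).
  have h2 := L2dot_le_fnorm D2 (J f) (J (s n) - J t).
  have := L2norm_ge0 (J f).
  move: h1 h2 n1 n2.
  move: (L2norm _) (`|_|) (`|_|) (fnorm _ _) (fnorm _ _) => *.
  nra.
Qed.

End Projection.

(** * One step of a Barlow-Evans sequence *)

Section Borel.
Variable R : realType.
Variables T U : ptopologicalType.

Lemma continuous_borel (f : T -> U) : continuous f ->
  measurable_fun setT (f : borel T -> borel U).
Proof.
move=> /continuousP cf.
apply: (@measurability _ _ (borel T) (borel U) _ _ (@open U)) => //.
move=> _ [A oA <-]; rewrite setTI.
by apply: sub_sigma_algebra; exact: cf.
Qed.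

Lemma continuous_borel_real (f : T -> R) : continuous f ->
  measurable_fun setT (f : borel T -> R).
Proof.
move=> /continuousP cf.
apply: (measurability _ (RGenOpens.measurableE R)) => //.
move=> _ [_ [a [b ->] <-]]; rewrite setTI.
by apply: sub_sigma_algebra; apply: cf; exact: interval_open.
Qed.

End Borel.

Section C0.
Variable R : realType.

Lemma C0_fun0 (T : topologicalType) : C0_fun (fun _ : T => 0 : R).
Proof.
split; first by move=> x; exact: cvg_cst.
rewrite (_ : [set x | _] = set0) ?closure0; first exact: compact0.
by apply/seteqP; split=> x //=; rewrite eqxx.
Qed.

Lemma C0_fun_linear (T : topologicalType) (a : R) (f g : T -> R) :
  C0_fun f -> C0_fun g -> C0_fun (fun x => a * f x + g x).
Proof.
move=> [cf kf] [cg kg]; split.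
  move=> x; apply: cvgD; last exact: cg.
  by apply: cvgMr; exact: cf.
apply: subclosed_compact (compactU kf kg) _; first exact: closed_closure.
rewrite -closureU; apply: closureS => x /=.
have [->|f0] := eqVneq (f x) 0; last by left.
by rewrite mulr0 add0r; right.
Qed.

Lemma integrable_continuous_compact (G : ptopologicalType)
    (nu : probability (borel G) R) (h : G -> R) :
  compact [set: G] -> continuous h -> nu.-integrable setT (EFin \o h).
Proof.
move=> cG ch; apply: measurable_bounded_integrable => //.
- exact: (le_lt_trans (probability_le1 _ _) (ltry _)).
- exact: continuous_borel_real.
- have := compact_bounded (continuous_compact (continuous_subspaceT ch) cG).
  move=> [M [Mr hM]]; exists M; split=> // y My x _ /=.
  by apply: (hM y My); exists x.
Qed.

Section lincomb.
Context d (T : measurableType d) (m : {measure set T -> \bar R}) (n : nat).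
Variables (c : 'I_n -> R) (h : 'I_n -> T -> R).
Hypothesis hi : forall k, m.-integrable setT (EFin \o h k).

Let chi k : m.-integrable setT (EFin \o (fun x => c k * h k x)).
Proof.
have := integrableZl measurableT (c k) (hi k).
by apply: eq_integrable => // x _.
Qed.

Lemma integrable_lincomb :
  m.-integrable setT (EFin \o (fun x => \sum_(k < n) c k * h k x)).
Proof.
rewrite (_ : EFin \o _ = fun x => (\sum_(k < n) (c k * h k x)%:E)%E).
  by apply: integrable_sum => // k _; exact: chi.
by apply/funext => x; rewrite /= sumEFin.
Qed.

Lemma Rintegral_lincomb :
  \int[m]_x (\sum_(k < n) c k * h k x) = \sum_(k < n) c k * \int[m]_x h k x.
Proof.
rewrite /Rintegral.
under eq_integral do rewrite -sumEFin.
rewrite (integral_sum measurableT chi) -sum_fine; last first.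
  by move=> k _; exact: integrable_fin_num.
by apply: eq_bigr => k _; exact: RintegralZl.
Qed.

End lincomb.

End C0.

Section GlueStep.
Variables (F G : ptopologicalType) (B : set F).
Local Notation gpi := (glue_pi G B).
Local Notation gphi := (glue_phi G B).

Lemma glue_phi_pi xg : gphi (gpi xg) = xg.1.
Proof. by rewrite /glue_pi; case: pselect. Qed.

Lemma glue_pi_surj y : exists x, gpi x = y.
Proof.
case: y => [[[x nBx] g]|[x Bx]].
  exists (x, g); rewrite /glue_pi; case: pselect => //= nBx'.
  by rewrite (Prop_irrelevance nBx' nBx).
exists (x, point); rewrite /glue_pi; case: pselect => //= Bx'.
by rewrite (Prop_irrelevance Bx' Bx).
Qed.

Lemma glue_pi_continuous : continuous gpi.
Proof. by apply: (continuousP gpi).2 => A oA; exact: oA. Qed.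

Lemma glue_phi_continuous : continuous gphi.
Proof.
apply: (continuousP gphi).2 => A oA.
suff : open (gpi @^-1` (gphi @^-1` A)) by [].
have -> : gpi @^-1` (gphi @^-1` A) = fst @^-1` A.
  by apply/seteqP; split => x /=; rewrite glue_phi_pi.
have fstc : continuous (@fst F G) by move=> x; exact: cvg_fst.
exact: ((continuousP _).1 fstc).
Qed.

(** The preimage under phi of a compact set K is pi(K x G), which is compact
    because G is. *)
Lemma C0_fun_glue_phi (R : realType) (f : F -> R) : compact [set: G] ->
  C0_fun f -> C0_fun (f \o gphi).
Proof.
move=> cG [cf kf]; split.
  by move=> x; apply: continuous_comp; [exact: glue_phi_continuous|exact: cf].
set K := closure [set x | f x != 0] in kf.
have cK : closed (gphi @^-1` K).
  apply: closed_comp; last exact: closed_closure.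
  by move=> x _; exact: glue_phi_continuous.
apply: (@subclosed_compact _ _ (gphi @^-1` K)); first exact: closed_closure.
- have -> : gphi @^-1` K = gpi @` (K `*` setT).
    apply/seteqP; split=> [y Ky|_ [[x g] [Kx _] <-]].
      have [xg xgy] := glue_pi_surj y; exists xg => //; split=> //=.
      by rewrite -glue_phi_pi xgy.
    by rewrite /= glue_phi_pi.
  apply: continuous_compact; last exact: compact_setX.
  apply: continuous_subspaceT; exact: glue_pi_continuous.
- rewrite [X in _ `<=` X](closure_id _).1//; apply: closureS => y /= fy.
  exact: subset_closure.
Qed.

Variable R : realType.
Variable mu : {measure set (borel F) -> \bar R}.
Variable nu : probability (borel G) R.
Variable mu' : {measure set (borel (glue_space G B)) -> \bar R}.
Hypothesis muE : forall A : set (borel (glue_space G B)), measurable A ->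
  mu' A = (mu \x nu)%E (gpi @^-1` A).

Lemma measurable_glue_phi :
  measurable_fun setT (gphi : borel (glue_space G B) -> borel F).
Proof. exact: (continuous_borel glue_phi_continuous). Qed.

Lemma glue_phi_measure (A : set (borel F)) : measurable A ->
  mu' (gphi @^-1` A) = mu A.
Proof.
move=> mA; rewrite muE; last first.
  by rewrite -[_ @^-1` _]setTI; exact: measurable_glue_phi.
have -> : gpi @^-1` (gphi @^-1` A) = A `*` setT.
  by apply/seteqP; split => x /=; rewrite glue_phi_pi// => -[].
transitivity (mu A * nu setT)%E; last by rewrite probability_setT mule1.
exact: (@product_measure1E _ _ (borel F) (borel G) R mu nu A setT).
Qed.

Lemma glue_sigma_finite : sigma_finite setT mu -> sigma_finite setT mu'.
Proof.
move=> [A TA mA]; exists (fun n => gphi @^-1` A n).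
  by rewrite -preimage_bigcup -TA preimage_setT.
move=> n; have [mAn An] := mA n; split; last by rewrite glue_phi_measure.
by rewrite -[_ @^-1` _]setTI; exact: measurable_glue_phi.
Qed.

End GlueStep.

Section GlueDot.
Variables (F G : ptopologicalType) (B : set F).
Local Notation gpi := (glue_pi G B).
Local Notation gphi := (glue_phi G B).
Variable R : realType.
Variable mu : {measure set (borel F) -> \bar R}.
Variable nu : probability (borel G) R.
Variable mu' : {measure set (borel (glue_space G B)) -> \bar R}.
Hypothesis muE : forall A : set (borel (glue_space G B)), measurable A ->
  mu' A = (mu \x nu)%E (gpi @^-1` A).
Hypothesis cG : compact [set: G].
Hypothesis sfmu : sigma_finite setT mu.

(** Fubini: the integral of u(x) v(pi(x, g)) over the fibre is u(x) s(x). *)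
Lemma glue_dot (u s : L2 mu) (u' v : L2 mu') n
    (f : 'I_n -> F -> R) (h : 'I_n -> G -> R) :
  (u' : _ -> R) = (u : F -> R) \o gphi ->
  (forall k, continuous (f k)) -> (forall k, continuous (h k)) ->
  (forall x g, v (gpi (x, g)) = \sum_(k < n) f k x * h k g) ->
  (forall x, s x = \sum_(k < n) f k x * \int[nu]_g h k g) ->
  L2dot u' v = L2dot u s.
Proof.
move=> uE cf ch vE sE.
pose m1 : {sigma_finite_measure set (borel F) -> \bar R} :=
  HB.pack_for {sigma_finite_measure set (borel F) -> \bar R} (Measure.sort mu)
    (@isSFinite.Build _ _ _ mu (sfinite_measure_sigma_finite sfmu))
    (@isSigmaFinite.Build _ _ _ mu sfmu).
have hi k : nu.-integrable setT (EFin \o h k).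
  exact: integrable_continuous_compact.
pose W := (fun xg : borel F * borel G =>
  u xg.1 * \sum_(k < n) f k xg.1 * h k xg.2).
have mW : measurable_fun setT W.
  apply: measurable_funM.
    by apply: (measurableT_comp (f := u)) => //; exact: measurable_fst.
  apply: measurable_sum => k; apply: measurable_funM.
    apply: (measurableT_comp (f := f k : borel F -> R));
      last exact: measurable_fst.
    exact: continuous_borel_real.
  apply: (measurableT_comp (f := h k : borel G -> R));
    last exact: measurable_snd.
  exact: continuous_borel_real.
pose V := (fun y : borel (glue_space G B) => u' y * v y).
have VW : V \o gpi = W.
  by apply/funext => -[x g]; rewrite /V /W/= vE uE/= glue_phi_pi.
have mV : measurable_fun setT V by exact: measurable_funM.
have mVp : measurable_fun setT (V \o gpi : borel F * borel G -> R).
  by rewrite VW.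
have tr (A : set R) : measurable A ->
    (m1 \x nu)%E (gpi @^-1` (V @^-1` A)) = mu' (V @^-1` A).
  by move=> mA; rewrite muE// -[_ @^-1` _]setTI; exact: mV.
rewrite {1}/L2dot.
rewrite (transfer_Rintegral (m := (m1 \x nu)%E) mV mVp tr).
have iV : mu'.-integrable setT (EFin \o V) by exact: integrable_L2M.
have iW := transfer_integrable (m := (m1 \x nu)%E) mV mVp tr iV.
rewrite VW in iW.
rewrite /L2dot /Rintegral; congr fine.
transitivity (\int[m1 \x nu]_z (EFin \o W) z)%E.
  by apply: eq_integral => z _; rewrite /= -VW.
rewrite -(integral12_prod_meas1 iW); apply: eq_integral => x _.
rewrite /fubini_F /=.
have il := integrable_lincomb (f ^~ x) hi.
transitivity ((\int[nu]_g (u x * \sum_(k < n) f k x * h k g))%:E).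
  rewrite /Rintegral fineK//; apply: integrable_fin_num => //.
  have := integrableZl measurableT (u x) il.
  by apply: eq_integrable => // g _.
by rewrite RintegralZl// Rintegral_lincomb// sE.
Qed.

End GlueDot.

(** * The stages inside the limit *)

Lemma toL2K d (T : measurableType d) (R : realType)
    (mu : {measure set T -> \bar R}) (u : L2 mu) : toL2 mu (u : T -> R) = u.
Proof. exact: valKd. Qed.

Lemma toL2_in_fdom d (T : measurableType d) (R : realType)
    (mu : {measure set T -> \bar R}) (D : L2form mu) (f : T -> R) :
  in_fdom D f -> fdom D (toL2 mu f) /\ (toL2 mu f : T -> R) = f.
Proof. by case=> u Du <-; rewrite toL2K. Qed.

Lemma BE_phi_Phi (F0 : ptopologicalType) (t : BE_tower F0) i (x : BE_limit t) :
  @BE_phi F0 t i (BE_Phi i.+1 x) = BE_Phi i x.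
Proof. exact: (proj2_sig x i). Qed.

Lemma BE_Phi_continuous (F0 : ptopologicalType) (t : BE_tower F0) i :
  continuous (@BE_Phi F0 t i).
Proof.
pose coords (x : BE_limit t) : prod_topology (BE_F t) := sval x.
have coords_cont : continuous (coords : BE_limit t -> _).
  exact: (@initial_continuous _ _ coords).
move=> x.
exact: (@continuous_comp (BE_limit t) (prod_topology (BE_F t)) (BE_F t i)
  coords (fun y => y i) x (coords_cont x) (@proj_continuous _ (BE_F t) i _)).
Qed.

Section BarlowEvans.
Variables (R : realType) (F0 : ptopologicalType) (t : BE_tower F0).
Variable mu : forall i, {measure set (borel (BE_F t i)) -> \bar R}.
Variable nu : forall i, probability (borel (BE_G t i)) R.
Variable mu_lim : {measure set (borel (BE_limit t)) -> \bar R}.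
Variable D : forall i, L2form (mu i).
Variable D_lim : L2form mu_lim.
Hypothesis spaces : BE_spaces t.
Hypothesis measures : BE_measures mu nu.
Hypothesis limit_measure : BE_limit_measure mu mu_lim.
Hypothesis dirichlet0 : dirichlet_form (D 0%N).
Hypothesis regular0 : regular_form (D 0%N).
Hypothesis form_step : forall i, BE_form_step nu D i.
Hypothesis form_limit : BE_form_limit D D_lim.

Local Notation core := (@BE_core R F0 t mu D).

Let compactG i : compact [set: BE_G t i].
Proof. by have [_ /(_ i)[]] := spaces. Qed.

Let closedD i : closed_form (D i).
Proof. by case: i => [|i]; [case: dirichlet0|case: (form_step i)]. Qed.

Let nonnegD i : nonneg_symmetric_form (D i).
Proof. exact: proj1 (closedD i). Qed.

Let closed_lim : closed_form D_lim.
Proof. by case: form_limit. Qed.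

Let nonneg_lim : nonneg_symmetric_form D_lim.
Proof. exact: proj1 closed_lim. Qed.

Let core_dense i : is_core (D i) (@core i).
Proof. by case: i => [|i]; [exact: (proj1 regular0)|case: (form_step i)]. Qed.

Let core_fdom i f : core f -> in_fdom (D i) f.
Proof. exact: (proj1 (core_dense i)). Qed.

Let core_C0 i f : @core i f -> C0_fun (f : BE_F t i -> R).
Proof. by case: i f => [|i] f []. Qed.

Let core_toL2 i f : @core i f ->
  fdom (D i) (toL2 (mu i) f) /\ (toL2 (mu i) f : _ -> R) = f.
Proof. by move=> /core_fdom; exact: toL2_in_fdom. Qed.

Let sigma_finite_mu i : sigma_finite setT (mu i).
Proof.
elim: i => [|i IH]; first by have [[]] := measures.
have [_ _ /(_ i) mE] := measures.
exact: (glue_sigma_finite mE).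
Qed.

Lemma BE_core0 i : @core i (fun=> 0).
Proof.
case: i => [|i].
  split; last exact: C0_fun0.
  by exists 0 => //; exact: fdom0.
split; first exact: C0_fun0.
exists 0%N, (fun _ _ => 0), (fun _ _ => 0); split.
- by case.
- by case.
- by move=> x g; rewrite big_ord0.
Qed.

Lemma BE_core_linear i a f g : @core i f -> @core i g ->
  @core i (fun x => a * f x + g x).
Proof.
case: i f g => [|i] f g.
  move=> [[u Du uf] Cf] [[v Dv vg] Cg]; split; last exact: C0_fun_linear.
  by exists (a *: u + v); [exact: fdomP|rewrite -uf -vg].
move=> [Cf [n [fk [hk [fkC hkC fE]]]]] [Cg [m [fl [hl [flC hlC gE]]]]].
split; first exact: C0_fun_linear.
exists (n + m)%N,
  (fun k => match fintype.split k with inl k => fk k | inr l => fl l end),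
  (fun k => match fintype.split k with
            | inl k => fun x => a * hk k x | inr l => hl l end).
split.
- by move=> k; case: (fintype.split k).
- move=> k; case: (fintype.split k) => // j x; apply: cvgMr; exact: hkC.
- move=> x z; rewrite big_split_ord/= fE gE mulr_sumr; congr (_ + _).
    apply: eq_bigr => k _.
    by rewrite -[lshift m k]/(unsplit (inl k)) unsplitK; ring.
  by apply: eq_bigr => k _; rewrite -[rshift n k]/(unsplit (inr k)) unsplitK.
Qed.

Lemma BE_core_sum i n (c : 'I_n -> R) (f : 'I_n -> BE_F t i -> R) :
  (forall k, core (f k)) -> core (fun x => \sum_(k < n) c k * f k x).
Proof.
elim: n c f => [|n IH] c f fC.
  rewrite (_ : (fun _ => _) = fun=> 0); first exact: BE_core0.
  by apply/funext => x; rewrite big_ord0.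
rewrite (_ : (fun _ => _) = fun x => c ord0 * f ord0 x +
  \sum_(k < n) c (lift ord0 k) * f (lift ord0 k) x); last first.
  by apply/funext => x; rewrite big_ord_recl.
by apply: BE_core_linear; [exact: fC|exact: IH].
Qed.

Lemma BE_core_phi i f : @core i f -> @core i.+1 (f \o @BE_phi F0 t i).
Proof.
move=> fC; split.
  by apply: C0_fun_glue_phi; [exact: compactG|exact: core_C0].
exists 1%N, (fun=> f), (fun _ _ => 1); split=> //.
- by move=> k x; exact: cvg_cst.
- by move=> x g; rewrite big_ord1 mulr1 /= /BE_phi glue_phi_pi.
Qed.

Let measurable_Phi i :
  measurable_fun setT (BE_Phi i : borel (BE_limit t) -> borel (BE_F t i)).
Proof. exact: (continuous_borel (@BE_Phi_continuous F0 t i)). Qed.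

Definition BE_comp i : L2 (mu i) -> L2 mu_lim :=
  L2_comp (@measurable_Phi i) (@limit_measure i).
Arguments BE_comp : clear implicits.

Let measurable_phi i :
  measurable_fun setT
    (@BE_phi F0 t i : borel (BE_F t i.+1) -> borel (BE_F t i)).
Proof. exact: measurable_glue_phi. Qed.

Let phi_measure i (A : set (borel (BE_F t i))) : measurable A ->
  mu i.+1 (@BE_phi F0 t i @^-1` A) = mu i A.
Proof. by have [_ _ /(_ i) mE] := measures; exact: (glue_phi_measure mE). Qed.

Let lift_phi i : L2 (mu i) -> L2 (mu i.+1) :=
  L2_comp (@measurable_phi i) (@phi_measure i).
Arguments lift_phi : clear implicits.

Let BE_comp_lift i u : BE_comp i u = BE_comp i.+1 (lift_phi i u).
Proof.
by apply/val_inj/funext => x /=; rewrite BE_phi_Phi.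
Qed.

Definition L2core i : set (L2 (mu i)) := [set w | core (w : BE_F t i -> R)].
Arguments L2core : clear implicits.

Let L2core_fdom i : L2core i `<=` fdom (D i).
Proof. by move=> w /core_toL2[]; rewrite toL2K. Qed.

Let L2coreB i u v : L2core i u -> L2core i v -> L2core i (u - v).
Proof.
move=> uC vC; rewrite addrC -scaleN1r; exact: BE_core_linear vC uC.
Qed.

Let L2core_dense i u (e : R) : fdom (D i) u -> 0 < e ->
  exists2 v, L2core i v & fnorm (D i) (u - v) < e.
Proof. by move=> Du e0; exact: (proj2 (core_dense i)). Qed.

Let BE_comp_core i w : L2core i w -> fdom D_lim (BE_comp i w) /\
  fval D_lim (BE_comp i w) (BE_comp i w) = fval (D i) w w.
Proof.
move=> wC; have [_ [cl _] ce] := form_limit.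
have [|Dw _] := @toL2_in_fdom _ _ _ _ D_lim (BE_comp i w).
  by apply: cl; exists i, (w : BE_F t i -> R).
rewrite toL2K in Dw; split=> //.
have := ce i _ wC; rewrite toL2K.
by rewrite -[X in toL2 _ X]/(BE_comp i w : _ -> _) toL2K.
Qed.

Let BE_comp_linear i a u v :
  BE_comp i (a *: u + v) = a *: BE_comp i u + BE_comp i v.
Proof. exact: L2_comp_linear. Qed.

Let BE_comp_dot i u v : L2dot (BE_comp i u) (BE_comp i v) = L2dot u v.
Proof. exact: L2_comp_dot. Qed.

Lemma BE_comp_fdom i u : fdom (D i) u -> fdom D_lim (BE_comp i u).
Proof.
exact: (isom_fdom (nonnegD i) closed_lim (@BE_comp_linear i) (@BE_comp_dot i)
  (@L2core_fdom i) (@L2coreB i) (@L2core_dense i) (@BE_comp_core i)).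
Qed.

Lemma BE_comp_fval i u v : fdom (D i) u -> fdom (D i) v ->
  fval D_lim (BE_comp i u) (BE_comp i v) = fval (D i) u v.
Proof.
exact: (isom_fval (nonnegD i) closed_lim (@BE_comp_linear i) (@BE_comp_dot i)
  (@L2core_fdom i) (@L2coreB i) (@L2core_dense i) (@BE_comp_core i)).
Qed.

Let fval_sum i n (c : 'I_n -> R) (f : 'I_n -> BE_F t i -> R) u :
  (forall k, core (f k)) -> fdom (D i) u ->
  fval (D i) u (toL2 (mu i) (fun x => \sum_(k < n) c k * f k x)) =
  \sum_(k < n) c k * fval (D i) u (toL2 (mu i) (f k)).
Proof.
move=> + Du; elim: n c f => [|n IH] c f fC.
  rewrite big_ord0 (_ : (fun _ => _) = ((0 : L2 (mu i)) : _ -> R)); last first.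
    by apply/funext => x; rewrite big_ord0.
  rewrite toL2K (fval_sym (nonnegD i) Du (fdom0 (nonnegD i))).
  exact: (fval0l (nonnegD i)).
have [D0 E0] := core_toL2 (fC ord0).
pose g x := \sum_(k < n) c (lift ord0 k) * f (lift ord0 k) x.
have [D1 E1] : fdom (D i) (toL2 (mu i) g) /\ (toL2 (mu i) g : _ -> R) = g.
  by apply/core_toL2/BE_core_sum => k; exact: fC.
rewrite big_ord_recl -IH; last by move=> k; exact: fC.
rewrite -(fvalZr (nonnegD i))// -(fvalDr (nonnegD i))//; last exact: fdomZ.
congr (fval _ _ _); rewrite -[RHS]toL2K; congr (toL2 _ _).
by apply/funext => x; rewrite big_ord_recl -[in LHS]E0 -/(g x) -[in LHS]E1.
Qed.

(** The vector s is the average of v over the fibres; it stays in the core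
    because pi^* v is a finite sum of products.  Averaging is adjoint to
    composition with phi, for the form by the definition of E_(i+1) as an
    integral of E_i over the fibre, and for the inner product by Fubini. *)
Lemma BE_average i (v : L2 (mu i.+1)) : L2core i.+1 v ->
  exists s, [/\ L2core i s,
    forall u, L2core i u -> fval (D i.+1) (lift_phi i u) v = fval (D i) u s &
    forall f, L2dot (lift_phi i f) v = L2dot f s].
Proof.
move=> vC; have [_ [n [f [h [fC hC vE]]]]] := vC.
pose S x := \sum_(k < n) (\int[nu i]_g h k g) * f k x.
have SC : core S by exact: BE_core_sum.
have [DS SE] := core_toL2 SC.
exists (toL2 (mu i) S); split.
- by rewrite /L2core/= SE.
- move=> u uC; have Du := L2core_fdom uC.
  have [_ _ st] := form_step i.
  have := st _ _ (BE_core_phi uC) vC.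
  rewrite toL2K.
  rewrite -[(u : BE_F t i -> R) \o _]/(lift_phi i u : _ -> R) toL2K => ->.
  rewrite [RHS]fval_sum//.
  have hi k : (nu i).-integrable setT (EFin \o h k).
    by apply: integrable_continuous_compact => //; exact: compactG.
  have := Rintegral_lincomb (fun k => fval (D i) u (toL2 (mu i) (f k))) hi.
  under [in RHS]eq_bigr do rewrite mulrC.
  move=> <-; apply: eq_Rintegral => g _.
  have -> : (fun x => lift_phi i u (BE_pi (x, g))) = (u : BE_F t i -> R).
    by apply/funext => x; rewrite /= /BE_phi glue_phi_pi.
  rewrite toL2K.
  have -> : (fun x => v (BE_pi (x, g))) = (fun x => \sum_(k < n) h k g * f k x).
    by apply/funext => x; rewrite vE; apply: eq_bigr => k _; rewrite mulrC.
  by rewrite fval_sum//; apply: eq_bigr => k _; rewrite mulrC.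
- move=> u; have [_ _ /(_ i) mE] := measures.
  apply: (glue_dot mE (@compactG i) (@sigma_finite_mu i)
    (f := f) (h := h)) => //.
  + by move=> k; have [] := core_C0 (fC k).
  + by move=> x; rewrite SE; apply: eq_bigr => k _; rewrite mulrC.
Qed.

(** Inside L^2 of the limit the pulled back cores increase with k and are dense
    in the form domain, and [BE_average] projects each of them onto the
    previous one. *)
Lemma BE_projection i v : fdom D_lim v -> exists s, [/\ fdom (D i) s,
  forall u, fdom (D i) u -> fval D_lim (BE_comp i u) v =
    fval D_lim (BE_comp i u) (BE_comp i s) &
  forall f, L2dot (BE_comp i f) v = L2dot (BE_comp i f) (BE_comp i s)].
Proof.
pose X k := BE_comp k @` L2core k.
pose H k := range (BE_comp k).
have Xmono k : X k `<=` X k.+1.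
  move=> _ [w wC <-]; exists (lift_phi k w); last by rewrite -BE_comp_lift.
  exact: BE_core_phi.
have Hmono k : H k `<=` H k.+1.
  by move=> _ [w _ <-]; exists (lift_phi k w) => //; rewrite -BE_comp_lift.
have Xstep k x : X k.+1 x -> exists s, [/\ X k s,
    forall u, X k u -> fval D_lim u x = fval D_lim u s &
    forall f, H k f -> L2dot f x = L2dot f s].
  move=> [w wC <-]; have [s [sC s1 s2]] := BE_average wC.
  exists (BE_comp k s); split; first by exists s.
  - move=> _ [u uC <-].
    rewrite (BE_comp_fval (L2core_fdom uC) (L2core_fdom sC)) BE_comp_lift.
    rewrite BE_comp_fval ?s1//; last exact: L2core_fdom.
    by apply: L2core_fdom; exact: BE_core_phi.
  - by move=> _ [f _ <-]; rewrite BE_comp_dot BE_comp_lift BE_comp_dot.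
pose Xall := \bigcup_k X k.
apply: (form_projection (closedD i) nonneg_lim (@BE_comp_linear i)
  (@BE_comp_dot i) (@BE_comp_fdom i) (@BE_comp_fval i)
  (@L2core_fdom i) (@L2coreB i) (@L2core_dense i) (X := Xall)).
- by move=> _ [k _ [w wC <-]]; exact: BE_comp_fdom (L2core_fdom wC).
- move=> u e Du e0; have [_ [_ cd] _] := form_limit.
  have [x [k [f fC xE]] ux] := cd _ _ Du e0.
  exists x => //; exists k => //; exists (toL2 (mu k) f).
    by rewrite /L2core/= (proj2 (core_toL2 fC)).
  by apply/val_inj; rewrite /= (proj2 (core_toL2 fC)) xE.
- move=> x [k _ Xx].
  have [_ [[s sC <-] s1 s2]] := chain_proj Xmono Hmono Xstep i Xx.
  exists s; split=> //; first by move=> u uC; apply: s1; exists u.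
  by move=> f; apply: s2; exists f.
Qed.

End BarlowEvans.

(** * Invariance of the spaces under the spectral projections *)

Section SpectralStability.
Variables (R : realType) (F0 : ptopologicalType) (t : BE_tower F0).
Variable mu : forall i, {measure set (borel (BE_F t i)) -> \bar R}.
Variable nu : forall i, probability (borel (BE_G t i)) R.
Variable mu_lim : {measure set (borel (BE_limit t)) -> \bar R}.
Variable D : forall i, L2form (mu i).
Variable D_lim : L2form mu_lim.
Variable E : R -> L2 mu_lim -> L2 mu_lim.
Hypothesis spaces : BE_spaces t.
Hypothesis measures : BE_measures mu nu.
Hypothesis limit_measure : BE_limit_measure mu mu_lim.
Hypothesis dirichlet0 : dirichlet_form (D 0%N).
Hypothesis regular0 : regular_form (D 0%N).
Hypothesis form_step : forall i, BE_form_step nu D i.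
Hypothesis form_limit : BE_form_limit D D_lim.
Hypothesis resolution : spectral_resolution (laplacian D_lim) E.

Local Notation pullback := (@BE_pullback R F0 t mu mu_lim _).

Let nonneg_lim : nonneg_symmetric_form D_lim.
Proof. by case: form_limit => -[]. Qed.

Let J i : L2 (mu i) -> L2 mu_lim := @BE_comp R F0 t mu mu_lim limit_measure i.

Let J_fdom i (u : L2 (mu i)) : fdom (D i) u -> fdom D_lim (J u).
Proof.
exact: (BE_comp_fdom limit_measure dirichlet0 regular0 form_step form_limit).
Qed.

Let J_fval i (u v : L2 (mu i)) : fdom (D i) u -> fdom (D i) v ->
  fval D_lim (J u) (J v) = fval (D i) u v.
Proof.
exact: (BE_comp_fval limit_measure dirichlet0 regular0 form_step form_limit).
Qed.

Let J_dot i (u v : L2 (mu i)) : L2dot (J u) (J v) = L2dot u v.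
Proof. exact: L2_comp_dot. Qed.

Let projection i v : fdom D_lim v -> exists s : L2 (mu i), [/\ fdom (D i) s,
  forall u, fdom (D i) u -> fval D_lim (J u) v = fval D_lim (J u) (J s) &
  forall f : L2 (mu i), L2dot (J f) v = L2dot (J f) (J s)].
Proof.
exact: (BE_projection spaces measures limit_measure dirichlet0 regular0
  form_step form_limit).
Qed.

(** Against a test function v, replace v by its projection P v = J_i s: then
    E_oo(J_i u, v) = E_i(u, s) = <f, s> = <J_i f, v>. *)
Lemma laplacian_BE_comp i u f : laplacian (D i) u f ->
  laplacian D_lim (J u) (J f).
Proof.
move=> [Du uf]; split; first exact: J_fdom.
move=> v Dv; have [s [Ds s1 s2]] := projection i Dv.
by rewrite s1// s2 J_fval// J_dot uf.
Qed.

Lemma laplacian_BE_compK i u f : fdom (D i) u ->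
  laplacian D_lim (J u) (J f) -> laplacian (D i) u f.
Proof.
move=> Du [_ uf]; split=> // v Dv.
by rewrite -J_fval// uf ?J_dot//; exact: J_fdom.
Qed.

Lemma pullback_domL_lim i f : pullback (domL (D i)) f -> domL D_lim f.
Proof.
move=> [u [g ug] fu].
apply: (domL_ae nonneg_lim (aeq_sym (g := J u) fu)).
by exists (J g); exact: laplacian_BE_comp.
Qed.

(** [reducing_resol_laplacian] applies to Y = J_i(domain of E_i), with the
    projection of [BE_projection]; [laplacian_BE_compK] then brings the
    equation found there back to F_i. *)
Lemma resol_pullback_domL l i f : pullback (domL (D i)) f ->
  pullback (domL (D i)) (E l f).
Proof.
move=> [u [g ug] fu].
have ex v : exists s : L2 (mu i), fdom D_lim v -> [/\ fdom (D i) s,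
    forall u, fdom (D i) u -> fval D_lim (J u) v = fval D_lim (J u) (J s) &
    forall f : L2 (mu i), L2dot (J f) v = L2dot (J f) (J s)].
  have [Dv|nDv] := pselect (fdom D_lim v); last by exists 0.
  by have [s hs] := projection i Dv; exists s.
have [S SP] := choice ex.
pose Y : set (L2 mu_lim) := @J i @` fdom (D i).
have YD : Y `<=` fdom D_lim by move=> _ [w Dw <-]; exact: J_fdom.
have PY v : fdom D_lim v -> Y (J (S v)).
  by move=> Dv; have [DS _ _] := SP _ Dv; exists (S v).
have Pdot w v : Y w -> fdom D_lim v -> L2dot w v = L2dot w (J (S v)).
  by move=> [x Dx <-] Dv; have [_ _ ->] := SP _ Dv.
have Pval w v : Y w -> fdom D_lim v -> fval D_lim w v = fval D_lim w (J (S v)).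
  by move=> [x Dx <-] Dv; have [_ h _] := SP _ Dv; exact: h.
have Yu : Y (J u) by exists u => //; exact: (proj1 ug).
have [_ [_ [[p Dp <-] [q Dq <-] Ep pq]]] :=
  reducing_resol_laplacian nonneg_lim resolution YD PY Pdot Pval l Yu.
exists p; first by exists q; exact: laplacian_BE_compK.
exact: (aeq_trans (resol_ae resolution l (g := J u) fu) Ep).
Qed.

Local Notation Dpr := (Dprime mu_lim D).

Lemma Dprime_belowP i g : @Dprime_below R F0 t mu mu_lim D i g <->
  exists2 j, (j < i)%N & Dpr j g.
Proof.
elim: i => [|i IH]; first by split=> // -[].
split=> [[/IH[j ji gj]|gi]|[j + gj]].
- by exists j => //; exact: ltnW.
- by exists i.
- rewrite ltnS leq_eqVlt => /predU1P[ji|ji]; first by right; rewrite -ji.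
  by left; apply/IH; exists j.
Qed.

Lemma pullback_ae i (S : set (L2 (mu i))) (f g : L2 mu_lim) :
  f = g %[ae mu_lim] ->
  pullback S f -> pullback S g.
Proof.
move=> fg [u Su fu]; exists u => //.
exact: (aeq_trans (aeq_sym fg) (h := J u) fu).
Qed.

Lemma Dprime_ae i (f g : L2 mu_lim) : f = g %[ae mu_lim] -> Dpr i f -> Dpr i g.
Proof.
move=> fg [fi fo]; split; first exact: pullback_ae fg fi.
by move=> h hb; rewrite -(L2dot_ae _ fg); exact: fo.
Qed.

(** For g in a lower space, <E_l f, g> = <f, E_l g> = 0 by induction. *)
Lemma resol_Dprime l i f : Dpr i f -> Dpr i (E l f).
Proof.
elim/ltn_ind: i f => i IH f [fi fo]; split; first exact: resol_pullback_domL.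
move=> g /Dprime_belowP[j ji gj].
rewrite (resol_sym resolution); apply: fo; apply/Dprime_belowP.
by exists j => //; exact: IH.
Qed.

Lemma Dprime_resol l i :
  Dpr i `&` ae_image (E l) (domL D_lim) = ae_image (E l) (Dpr i).
Proof.
apply/seteqP; split=> [f [fi [h _ fh]]|f [g gi fg]].
  exists f => //.
  apply: (aeq_trans fh); apply: aeq_sym.
  exact: (aeq_trans (resol_ae resolution l fh) (resol_idem resolution l h)).
split; first exact: (Dprime_ae (aeq_sym fg) (resol_Dprime l gi)).
by exists g => //; exact: pullback_domL_lim (proj1 gi).
Qed.

End SpectralStability.

Theorem theorem5p2 (R : realType) (F0 : ptopologicalType) (t : BE_tower F0)
    (mu : forall i, {measure set (borel (BE_F t i)) -> \bar R})
    (nu : forall i, probability (borel (BE_G t i)) R)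
    (mu_lim : {measure set (borel (BE_limit t)) -> \bar R})
    (D : forall i, L2form (mu i)) (D_lim : L2form mu_lim)
    (E : R -> L2 mu_lim -> L2 mu_lim) :
  BE_spaces t ->
  BE_measures mu nu ->
  BE_limit_measure mu mu_lim ->
  dirichlet_form (D 0%N) -> regular_form (D 0%N) ->
  (forall i, BE_form_step nu D i) ->
  BE_form_limit D D_lim ->
  spectral_resolution (laplacian D_lim) E ->
  forall (lambda : R) (i : nat),
    Dprime mu_lim D i `&` ae_image (E lambda) (domL D_lim) =
    ae_image (E lambda) (Dprime mu_lim D i).
Proof.
move=> spaces measures limit_measure dirichlet0 regular0 form_step form_limit.
move=> resolution lambda i.
exact: (Dprime_resol spaces measures limit_measure dirichlet0 regular0
  form_step form_limit resolution).
Qed.
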